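(* Let $n\ge2$ and let $P$ be a positive regular polynomial $n$-tuple. The $P$-triangle $\triangle^n_P$ is a domain of holomorphy.
   Context: $\mathbb C_*=\mathbb C\setminus\{0\}$; $z\diamond w=(z_1w_1,\ldots,z_nw_n)$; $\overline z$ is the entrywise conjugate. For $n\ge2$, $\varphi(z)=\big(\frac{z_1}{z_2},\ldots,\frac{z_{n-1}}{z_n},z_n\big)$ for $z\in\mathbb C\times\mathbb C_*^{n-1}$. A polynomial $n$-tuple $P=(P_1,\ldots,P_n)$ in $\mathbb C[z_1,\ldots,z_n]$ is positive regular if for each $j$, $P_j$ has nonnegative coefficients and $P_j(z)=a_jz_j+\sum_{k=2}^{N_j}Q_{jk}(z)$ with $a_j>0$ and $Q_{jk}$ homogeneous of degree $k$. The $P$-triangle is $\triangle^n_P=\{z\in\mathbb C\times\mathbb C_*^{n-1}:P_j(\varphi(z)\diamond\overline{\varphi(z)})<1,\ j=1,\ldots,n\}$. *)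

(* Defs.v *)
From HB Require Import structures.
From mathcomp Require Import all_boot all_order all_algebra.
From mathcomp Require Import all_classical all_reals all_analysis.
From mathcomp Require Import complex.
From mathcomp Require Import -(notations) mpoly.

Set Implicit Arguments.
Unset Strict Implicit.
Unset Printing Implicit Defensive.

Import Order.TTheory GRing.Theory Num.Theory.
Import numFieldNormedType.Exports.

Local Open Scope classical_set_scope.
Local Open Scope ring_scope.

(* The sort of a numClosedFieldType, unlike the bare R[i], receives the norm
   topology from numFieldNormedType.Exports, and so does 'rV[Cplx R]_n. *)
Definition Cplx (R : realType) : numClosedFieldType := R[i].

Section SeveralComplexVariables.
Variables (R : realType) (n : nat).
Local Notation C := (Cplx R).
Implicit Types (U V W : set 'rV[C]_n) (f g : 'rV[C]_n -> C).

(* Differentiability is over the scalars C, i.e., complex Frechet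
   differentiability. *)
Definition holomorphic W f := forall z, W z -> differentiable f z.

Definition domain W := [/\ open W, connected W & W !=set0].

(* f and its extension g need only agree on U, not on all of W `&` V, so that a
   domain all of whose holomorphic functions extend to an overlapping sheet is
   not a domain of holomorphy either. *)
Definition domain_of_holomorphy W :=
  domain W /\
  ~ exists U V,
      [/\ open U, U !=set0 & U `<=` W `&` V] /\
      [/\ open V, connected V & ~ (V `<=` W)] /\
      (forall f, holomorphic W f ->
         exists g, holomorphic V g /\ forall z, U z -> f z = g z).

End SeveralComplexVariables.

Section PTriangle.
Variables (R : realType) (n : nat).
Local Notation C := (Cplx R).
Local Notation polynomial := (mpoly n C).
Implicit Types (z w : 'rV[C]_n) (P : 'I_n -> polynomial).

Definition diamond z w : 'rV[C]_n := map2_mx *%R z w.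

Definition conj_vec z : 'rV[C]_n := map_mx Num.conj z.

(* insub j.+1 is the next index, or None when j is the last one. *)
Definition phi z : 'rV[C]_n :=
  \row_j (if insub j.+1 is Some k then z 0 j / z 0 k else z 0 j).

(* In the order of C, 0 <= x (resp. 0 < x) entails that x is real. *)
Definition positive_regular P := forall j : 'I_n,
  (forall m, 0 <= mcoeff m (P j)) /\
  exists (a : C) (N : nat) (Q : nat -> polynomial),
    [/\ 0 < a,
        (forall k, (2 <= k <= N)%N -> Q k \is ishomog1 k (@mdeg n))
      & P j = a *: mpolyX C (mnm1 j) + \sum_(2 <= k < N.+1) Q k].

(* For positive regular P the evaluated polynomials have nonnegative real
   values here, so that < 1 is the usual inequality. *)
Definition P_triangle P : set 'rV[C]_n :=
  [set z : 'rV[C]_n | (forall k : 'I_n, (0 < k)%N -> z 0 k != 0) /\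
           forall j : 'I_n,
             meval (diamond (phi z) (conj_vec (phi z)) 0) (P j) < 1].

End PTriangle.

(* Main.v *)
Require Import Defs.
From mathcomp Require Import all_boot all_order all_algebra.
From mathcomp Require Import all_classical all_reals all_analysis.
From mathcomp Require Import complex.
From mathcomp Require Import ring lra.
From mathcomp Require Import -(notations) mpoly.

(* A point p of the boundary of W = P_triangle P has either p_k = 0 for some
   k > 0, and then 1 / z_k is singular there, or P_j (|phi p| ^ 2) = 1 for some
   j.  In the latter case q z = 1 - P_j (phi z <> conj (phi p)) vanishes at p, and
   has no zero in W: as the coefficients of P_j are nonnegative, AM-GM on each
   monomial gives
     |P_j (phi z <> conj (phi p))| <= (P_j (|phi z| ^ 2) + P_j (|phi p| ^ 2)) / 2,
   which is less than 1 on W.  A holomorphic continuation g of 1 / q across p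
   would satisfy g q = 1 by unique continuation, contradicting q p = 0.

   Unique continuation reduces to complex lines. There it follows from Goursat's
   theorem (proved by quadrisection of rectangles) and the resulting Cauchy
   estimate |g w| <= K sup |g|, applied to f / z ^ N with N large when f vanishes
   near 0.

   The domain W is connected because phi is a homeomorphism from W onto a
   Reinhardt set which is stable under w |-> e w for 0 < e <= 1. *)

Set Implicit Arguments.
Unset Strict Implicit.
Unset Printing Implicit Defensive.

Import Order.TTheory GRing.Theory Num.Theory.
Import numFieldNormedType.Exports.
Import Normc.

Local Open Scope classical_set_scope.
Local Open Scope ring_scope.

Local Notation Re := (@complex.Re _).
Local Notation Im := (@complex.Im _).

(** * Complex modulus and integrals of complex-valued functions *)

Section ComplexModulus.
Variable R : realType.
Local Notation C := (Cplx R).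
Implicit Types z w : C.

(** The norm of [C] takes its values in [C] itself; estimates are made with the real-valued [normc]
    and transferred along this identity. *)
Lemma normr_normc z : `|z| = ((normc z)%:C)%C.
Proof. by []. Qed.

Lemma ReB z w : Re (z - w) = Re z - Re w.
Proof. by case: z; case: w. Qed.

Lemma ImB z w : Im (z - w) = Im z - Im w.
Proof. by case: z; case: w. Qed.

Lemma ReD z w : Re (z + w) = Re z + Re w.
Proof. by case: z; case: w. Qed.

Lemma Re_mulc z w : Re (z * w) = Re z * Re w - Im z * Im w.
Proof. by case: z; case: w. Qed.

Lemma Im_mulc z w : Im (z * w) = Re z * Im w + Im z * Re w.
Proof. by case: z; case: w => a b c d /=; rewrite addrC. Qed.

Lemma normc_ge0 z : 0 <= normc z.
Proof. by case: z => a b /=; exact: sqrtr_ge0. Qed.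

Lemma normcD z w : normc (z + w) <= normc z + normc w.
Proof. exact: le_normcD. Qed.

Lemma Re_le_normc z : `|Re z| <= normc z.
Proof.
case: z => a b /=; rewrite -sqrtr_sqr ler_sqrt ?addr_ge0 ?sqr_ge0 //.
by rewrite lerDl sqr_ge0.
Qed.

Lemma Im_le_normc z : `|Im z| <= normc z.
Proof.
case: z => a b /=; rewrite -sqrtr_sqr ler_sqrt ?addr_ge0 ?sqr_ge0 //.
by rewrite lerDr sqr_ge0.
Qed.

Lemma normc_le z : normc z <= `|Re z| + `|Im z|.
Proof.
case: z => a b /=; rewrite -[leRHS]ger0_norm ?addr_ge0 // -sqrtr_sqr.
rewrite ler_sqrt ?sqr_ge0 // sqrrD !real_normK ?num_real //.
have : 0 <= `|a| * `|b| by rewrite mulr_ge0.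
by move: (`|a| * `|b|) => t; lra.
Qed.

Lemma normc_gt0 z : (0 < normc z) = (z != 0).
Proof. by rewrite -[RHS]normr_gt0 normr_normc ltcR. Qed.

Lemma normcX z k : normc (z ^+ k) = normc z ^+ k.
Proof.
elim: k => [|k IH]; first by rewrite !expr0 normc1.
by rewrite !exprS normcM IH.
Qed.

Lemma Re_continuous : continuous (@complex.Re R : C -> R).
Proof.
move=> z; apply/(@cvgrPdist_lt _ _ _ _ (nbhs_filter z)) => e e0; apply/nbhs_ballP.
exists (e%:C)%C => [|w zw]; first by rewrite /= ltcR.
by rewrite -ReB (le_lt_trans (Re_le_normc _))// -ltcR -normr_normc.
Qed.

Lemma Im_continuous : continuous (@complex.Im R : C -> R).
Proof.
move=> z; apply/(@cvgrPdist_lt _ _ _ _ (nbhs_filter z)) => e e0; apply/nbhs_ballP.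
exists (e%:C)%C => [|w zw]; first by rewrite /= ltcR.
by rewrite -ImB (le_lt_trans (Im_le_normc _))// -ltcR -normr_normc.
Qed.

Lemma cvg_complex (T : Type) (F : set_system T) {FF : Filter F} (u : T -> C) z :
  (fun t => Re (u t)) @ F --> Re z -> (fun t => Im (u t)) @ F --> Im z -> u @ F --> z.
Proof.
move=> /cvgrPdist_lt ur /cvgrPdist_lt ui; apply/cvgrPdist_lt => -[e e'].
(* Radii of balls are elements of [C]; being positive makes this one real. *)
rewrite ltcE /= => /andP[/eqP -> e0].
have e20 : 0 < e / 2 by rewrite divr_gt0.
near=> t; rewrite normr_normc complexr0 ltcR (le_lt_trans (normc_le _))// ReB ImB.
rewrite (splitr e) ltrD//; near: t; [exact: ur|exact: ui].
Unshelve. all: by end_near. Qed.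

Lemma hline_continuous c : continuous ((fun x => x +i* c)%C : R -> C).
Proof. by move=> x; apply: cvg_complex; [exact: cvg_id|exact: cvg_cst]. Qed.

Lemma vline_continuous c : continuous ((fun y => c +i* y)%C : R -> C).
Proof. by move=> x; apply: cvg_complex; [exact: cvg_cst|exact: cvg_id]. Qed.

End ComplexModulus.

Section ComplexIntegral.
Variable R : realType.
Local Notation C := (Cplx R).
Local Notation mu := (@lebesgue_measure R).
Implicit Types (phi psi : R -> C) (a b c : R).

Definition cint phi a b : C :=
  ((\int[mu]_(t in `[a, b]) Re (phi t)) +i*
   (\int[mu]_(t in `[a, b]) Im (phi t)))%C.

(** Continuity is two-sided also at the end points, as results from restricting to a line a function
    continuous at each point of a segment. *)
Definition continuous_on phi a b :=
  forall t, a <= t <= b -> {for t, continuous phi}.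

Lemma integrable_Re phi a b : continuous_on phi a b ->
  mu.-integrable `[a, b] (EFin \o (fun t => Re (phi t))).
Proof.
move=> h; apply: continuous_compact_integrable; first exact: segment_compact.
apply: continuous_in_subspaceT => t /set_mem /=; rewrite in_itv /= => abt.
by apply: (continuous_comp (h _ abt)); exact: Re_continuous.
Qed.

Lemma integrable_Im phi a b : continuous_on phi a b ->
  mu.-integrable `[a, b] (EFin \o (fun t => Im (phi t))).
Proof.
move=> h; apply: continuous_compact_integrable; first exact: segment_compact.
apply: continuous_in_subspaceT => t /set_mem /=; rewrite in_itv /= => abt.
by apply: (continuous_comp (h _ abt)); exact: Im_continuous.
Qed.

Lemma cint_split phi a b m : a <= m <= b -> continuous_on phi a b ->
  cint phi a b = cint phi a m + cint phi m b.
Proof.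
move=> /andP[am mb] h.
have key (f : R -> R) : mu.-integrable `[a, b] (EFin \o f) ->
    \int[mu]_(t in `[a, b]) f t
    = \int[mu]_(t in `[a, m]) f t + \int[mu]_(t in `[m, b]) f t.
  (* The point [m] has measure zero; without it the second interval is disjoint from the first. *)
  move=> fi; rewrite -(Rintegral_itv_obnd_cbnd (r := m)); last first.
    apply: integrableS fi => //; apply: subset_itvr; by rewrite bnd_simp.
  rewrite -(@Rintegral_itvB _ f (BLeft a) (BRight b) m) ?bnd_simp//.
  by rewrite addrC subrK.
by rewrite /cint !key; [|exact: integrable_Im|exact: integrable_Re].
Qed.

Lemma cintB phi psi a b : continuous_on phi a b -> continuous_on psi a b ->
  cint (fun t => phi t - psi t) a b = cint phi a b - cint psi a b.
Proof.
move=> h k; rewrite /cint.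
under eq_Rintegral do rewrite ReB.
under [in X in (_ +i* X)%C]eq_Rintegral do rewrite ImB.
rewrite !RintegralB//; try exact: integrable_Im; exact: integrable_Re.
Qed.

Lemma cintZ k phi a b : continuous_on phi a b ->
  cint (fun t => k * phi t) a b = k * cint phi a b.
Proof.
move=> h; rewrite /cint.
have hr := integrable_Re h; have hi := integrable_Im h.
have Zi (f : R -> R) (r : R) : mu.-integrable `[a, b] (EFin \o f) ->
    mu.-integrable `[a, b] (EFin \o (fun t => r * f t)).
  by move=> fi; apply: (integrableZl _ r fi).
case: k => k l; rewrite [RHS]/GRing.mul /=.
under eq_Rintegral do rewrite Re_mulc /=.
under [in X in (_ +i* X)%C]eq_Rintegral do rewrite Im_mulc /=.
by rewrite RintegralB ?RintegralD ?RintegralZl//; apply: Zi.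
Qed.

Lemma cint_cst k a b : a <= b -> cint (fun=> k) a b = k * ((b - a)%:C)%C.
Proof.
move=> ab; rewrite /cint !Rintegral_cst//.
have -> : fine (mu `[a, b]%classic) = b - a.
  rewrite lebesgue_measure_itv /= lte_fin.
  by case: ltgtP ab => //= -> _; rewrite subrr.
by case: k => k l; apply/eqP; rewrite eq_complex /= !mulr0 subr0 add0r !eqxx.
Qed.

Lemma Re_cint_ge phi a b m : a <= b -> continuous_on phi a b ->
  (forall t, a <= t <= b -> m <= Re (phi t)) -> m * (b - a) <= Re (cint phi a b).
Proof.
move=> ab h hm; rewrite /=.
have -> : m * (b - a) = Re (cint (fun=> (m%:C)%C) a b).
  by rewrite cint_cst// Re_mulc /= mul0r subr0.
apply: le_Rintegral => //; last exact: integrable_Re.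
by apply: integrable_Re => t _; exact: cvg_cst.
Qed.

(** The factor 2 comes from bounding the real and the imaginary part separately. *)
Lemma normc_cint phi a b M : a <= b -> continuous_on phi a b ->
  (forall t, a <= t <= b -> normc (phi t) <= M) ->
  normc (cint phi a b) <= 2 * M * (b - a).
Proof.
move=> ab h hM; apply: (le_trans (normc_le _)).
have key (f : R -> R) : mu.-integrable `[a, b] (EFin \o f) ->
    (forall t, a <= t <= b -> `|f t| <= M) ->
    `|\int[mu]_(t in `[a, b]) f t| <= M * (b - a).
  move=> fi fM; apply: (le_trans (le_normr_Rintegral _ fi)) => //.
  have -> : M * (b - a) = Re (cint (fun=> (M%:C)%C) a b).
    by rewrite cint_cst// Re_mulc /= mul0r subr0.
  apply: le_Rintegral => //; first exact: integrable_norm fi.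
  by apply: integrable_Re => t _; exact: cvg_cst.
rewrite -mulrA mulr_natl mulr2n lerD// key//.
- exact: integrable_Re.
- by move=> t /hM; apply: le_trans; exact: Re_le_normc.
- exact: integrable_Im.
- by move=> t /hM; apply: le_trans; exact: Im_le_normc.
Qed.

End ComplexIntegral.

(** * Boundary integrals of rectangles *)

Section RectangleIntegral.
Variable R : realType.
Local Notation C := (Cplx R).
Implicit Types (f g : C -> C) (a b c d : R).

(** The counterclockwise integral of [f(z) dz] along the boundary of the rectangle, where [dz] is
    [dx] on horizontal sides and [i dy] on vertical ones. *)
Definition rint f a b c d : C :=
  cint (fun x => f (x +i* c)%C) a b + 'i%C * cint (fun y => f (b +i* y)%C) c d
  - cint (fun x => f (x +i* d)%C) a b - 'i%C * cint (fun y => f (a +i* y)%C) c d.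

Definition rect a b c d : set C :=
  [set z | a <= Re z <= b /\ c <= Im z <= d].

Definition frame a b c d : set C :=
  [set z | rect a b c d z /\ [\/ Re z = a, Re z = b, Im z = c | Im z = d]].

Definition continuous_frame f a b c d :=
  forall z, frame a b c d z -> {for z, continuous f}.

Lemma rectS a b c d a' b' c' d' : a <= a' -> b' <= b -> c <= c' -> d' <= d ->
  rect a' b' c' d' `<=` rect a b c d.
Proof. by move=> ? ? ? ? z [/andP[? ?] /andP[? ?]]; split; apply/andP; split; lra. Qed.

Lemma continuous_hline f c (x : R) : {for (x +i* c)%C, continuous f} ->
  {for x, continuous (fun x => f (x +i* c)%C)}.
Proof.
move=> h; have h2 := @hline_continuous R c x.
exact (@cvg_comp _ _ _ _ _ _ _ _ h2 h).
Qed.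

Lemma continuous_vline f c (y : R) : {for (c +i* y)%C, continuous f} ->
  {for y, continuous (fun y => f (c +i* y)%C)}.
Proof.
move=> h; have h2 := @vline_continuous R c y.
exact (@cvg_comp _ _ _ _ _ _ _ _ h2 h).
Qed.

Lemma continuous_frameP f a b c d : a <= b -> c <= d ->
  continuous_frame f a b c d ->
  [/\ continuous_on (fun x => f (x +i* c)%C) a b,
      continuous_on (fun x => f (x +i* d)%C) a b,
      continuous_on (fun y => f (a +i* y)%C) c d
    & continuous_on (fun y => f (b +i* y)%C) c d].
Proof.
move=> ab cd h; split=> t tab.
- by apply: continuous_hline; apply: h; split; [split=> //=; rewrite lexx|exact: Or43].
- by apply: continuous_hline; apply: h; split;
  [split=> //=; rewrite lexx andbT|exact: Or44].
- by apply: continuous_vline; apply: h; split; [split=> //=; rewrite lexx|exact: Or41].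
- by apply: continuous_vline; apply: h; split;
  [split=> //=; rewrite lexx andbT|exact: Or42].
Qed.

Lemma rintB f g a b c d : a <= b -> c <= d ->
  continuous_frame f a b c d -> continuous_frame g a b c d ->
  rint (fun z => f z - g z) a b c d = rint f a b c d - rint g a b c d.
Proof.
move=> ab cd /(continuous_frameP ab cd)[? ? ? ?] /(continuous_frameP ab cd)[? ? ? ?].
rewrite /rint !cintB//; ring.
Qed.

Lemma rintZ f k a b c d : a <= b -> c <= d -> continuous_frame f a b c d ->
  rint (fun z => k * f z) a b c d = k * rint f a b c d.
Proof.
move=> ab cd /(continuous_frameP ab cd)[? ? ? ?].
rewrite /rint !cintZ//; ring.
Qed.

Lemma continuous_affine (k l : C) : continuous (fun z : C => k + l * z).
Proof.
move=> z; have zF := nbhs_filter z.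
by apply: cvgD; [exact: cvg_cst|apply: cvgM; [exact: cvg_cst|exact: cvg_id]].
Qed.

(** The values on opposite sides differ by constants, [l i (c - d)] and [l (b - a)], and the two
    resulting contributions cancel. *)
Lemma rint_affine (k l : C) a b c d : a <= b -> c <= d ->
  rint (fun z => k + l * z) a b c d = 0.
Proof.
move=> ab cd; pose F := fun z : C => k + l * z.
have Fc : continuous_frame F a b c d by move=> z _; exact: continuous_affine.
have [F1 F2 F3 F4] := continuous_frameP ab cd Fc.
rewrite /rint -/F.
have -> : forall u v w x : C, u + 'i%C * v - w - 'i%C * x = (u - w) + 'i%C * (v - x).
  by move=> *; ring.
rewrite -(cintB F1 F2) -(cintB F4 F3).
have -> : (fun t : R => F (t +i* c)%C - F (t +i* d)%C)
   = fun=> l * ('i%C * (((c - d)%:C)%C : C)).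
  apply/funext => t; rewrite /F.
  have -> : forall u v : C, k + l * u - (k + l * v) = l * (u - v) by move=> *; ring.
  congr (_ * _); apply/eqP; rewrite eq_complex /= subrr.
  by apply/andP; split; apply/eqP; ring.
have -> : (fun t : R => F (b +i* t)%C - F (a +i* t)%C)
   = fun=> l * (((b - a)%:C)%C : C).
  apply/funext => t; rewrite /F.
  have -> : forall u v : C, k + l * u - (k + l * v) = l * (u - v) by move=> *; ring.
  by congr (_ * _); apply/eqP; rewrite eq_complex /= subrr !eqxx.
rewrite !cint_cst//.
have -> : ((c - d)%:C)%C = - ((d - c)%:C)%C :> C by rewrite -opprB rmorphN.
ring.
Qed.

(** The two parts run along their common side in opposite directions, so its integrals cancel
    formally and continuity is asked for on the outer frame alone. *)
Lemma rint_splitx f a b c d m : a <= m <= b -> c <= d -> continuous_frame f a b c d ->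
  rint f a b c d = rint f a m c d + rint f m b c d.
Proof.
move=> amb cd h; have ab : a <= b by case/andP: amb => /le_trans; exact.
case/(continuous_frameP ab cd): h => h1 h2 _ _.
rewrite /rint (cint_split amb h1) (cint_split amb h2); ring.
Qed.

Lemma rint_splity f a b c d m : a <= b -> c <= m <= d -> continuous_frame f a b c d ->
  rint f a b c d = rint f a b c m + rint f a b m d.
Proof.
move=> ab cmd h; have cd : c <= d by case/andP: cmd => /le_trans; exact.
case/(continuous_frameP ab cd): h => _ _ h1 h2.
rewrite /rint (cint_split cmd h1) (cint_split cmd h2); ring.
Qed.

Lemma normc_rint f a b c d M : a <= b -> c <= d -> continuous_frame f a b c d ->
  (forall z, frame a b c d z -> normc (f z) <= M) ->
  normc (rint f a b c d) <= 4 * M * ((b - a) + (d - c)).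
Proof.
move=> ab cd h hM.
have [h1 h2 h3 h4] := continuous_frameP ab cd h.
have ni (z : C) : normc ('i%C * z) = normc z.
  by rewrite normcM /= expr0n expr1n add0r sqrtr1 mul1r.
have nB (z w : C) : normc (z - w) <= normc z + normc w.
  by rewrite (le_trans (normcD _ _))// lerD2l normcN.
have b1 : normc (cint (fun x => f (x +i* c)%C) a b) <= 2 * M * (b - a).
  by apply: normc_cint => // t tab; apply: hM; split;
    [split=> //=; rewrite lexx|exact: Or43].
have b2 : normc (cint (fun x => f (x +i* d)%C) a b) <= 2 * M * (b - a).
  by apply: normc_cint => // t tab; apply: hM; split;
    [split=> //=; rewrite lexx andbT|exact: Or44].
have b3 : normc (cint (fun y => f (a +i* y)%C) c d) <= 2 * M * (d - c).
  by apply: normc_cint => // t tab; apply: hM; split;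
    [split=> //=; rewrite lexx|exact: Or41].
have b4 : normc (cint (fun y => f (b +i* y)%C) c d) <= 2 * M * (d - c).
  by apply: normc_cint => // t tab; apply: hM; split;
    [split=> //=; rewrite lexx andbT|exact: Or42].
rewrite /rint (le_trans (nB _ _))// ni.
apply: (le_trans (lerD (nB _ _) (lexx _))).
apply: (le_trans (lerD (lerD (normcD _ _) (lexx _)) (lexx _))).
by rewrite ni; lra.
Qed.

(** A compactness principle: a rectangle where [P] fails has a quarter where [P] fails, and the
    resulting nested sequence shrinks to a point, near which [P] holds for all small rectangles. *)
Lemma quadrisection (P : R -> R -> R -> R -> Prop) a b c d :
  a <= b -> c <= d ->
  (forall a b c d, a <= b -> c <= d ->
     P a ((a + b) / 2) c ((c + d) / 2) -> P a ((a + b) / 2) ((c + d) / 2) d ->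
     P ((a + b) / 2) b c ((c + d) / 2) -> P ((a + b) / 2) b ((c + d) / 2) d ->
     P a b c d) ->
  (forall x y, a <= x <= b -> c <= y <= d ->
     exists2 e, 0 < e & forall a' b' c' d', a' <= x <= b' -> c' <= y <= d' ->
       (b' - a') + (d' - c') < e -> P a' b' c' d') ->
  P a b c d.
Proof.
move=> ab cd split_P local_P; apply: contrapT => NP.
pose T := (R * R * R * R)%type.
pose bad (q : T) := let: (a, b, c, d) := q in [/\ a <= b, c <= d & ~ P a b c d].
pose sub (q r : T) := let: (a, b, c, d) := q in let: (a', b', c', d') := r in
  [/\ a <= a', b' <= b, c <= c', d' <= d
    & b' - a' = (b - a) / 2 /\ d' - c' = (d - c) / 2].
(* The premise [bad q] stands under the existential so that [choice] gives a total function to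
   iterate. *)
have step (q : T) : exists r : T, bad q -> bad r /\ sub q r.
  case: (pselect (bad q)) => [bq|nbq]; last by exists q.
  case: q bq => [[[a1 b1] c1] d1] [ab1 cd1 nP].
  set m := (a1 + b1) / 2; set l := (c1 + d1) / 2.
  have am : a1 <= m by rewrite /m; lra.
  have mb : m <= b1 by rewrite /m; lra.
  have cl : c1 <= l by rewrite /l; lra.
  have ld : l <= d1 by rewrite /l; lra.
  case: (pselect (P a1 m c1 l)) => [p1|p1]; last first.
    by exists (a1, m, c1, l) => _; split; split=> //; split; rewrite /m /l; lra.
  case: (pselect (P a1 m l d1)) => [p2|p2]; last first.
    by exists (a1, m, l, d1) => _; split; split=> //; split; rewrite /m /l; lra.
  case: (pselect (P m b1 c1 l)) => [p3|p3]; last first.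
    by exists (m, b1, c1, l) => _; split; split=> //; split; rewrite /m /l; lra.
  case: (pselect (P m b1 l d1)) => [p4|p4]; last first.
    by exists (m, b1, l, d1) => _; split; split=> //; split; rewrite /m /l; lra.
  by case: nP; exact: split_P.
have [next nextP] := choice step.
pose q k := iter k next (a, b, c, d).
pose A k := (q k).1.1.1; pose B k := (q k).1.1.2.
pose K k := (q k).1.2; pose D k := (q k).2.
have badq k : bad (q k).
  by elim: k => [//|k IH] /=; exact: (nextP _ IH).1.
have qE k : q k = (A k, B k, K k, D k) by rewrite /A /B /K /D; case: (q k) => [[[? ?] ?] ?].
have Bq k : [/\ A k <= B k, K k <= D k & ~ P (A k) (B k) (K k) (D k)].
  by have := badq k; rewrite qE.
have Sq k : sub (A k, B k, K k, D k) (A k.+1, B k.+1, K k.+1, D k.+1).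
  by rewrite -!qE; exact: (nextP _ (badq k)).2.
have mono j k : (j <= k)%N -> [/\ A j <= A k, B k <= B j, K j <= K k & D k <= D j].
  elim: k => [|k IH]; first by rewrite leqn0 => /eqP ->; split.
  rewrite leq_eqVlt => /orP[/eqP ->|]; first by split.
  rewrite ltnS => /IH [? ? ? ?]; have [? ? ? ? _] := Sq k.
  by split; lra.
have AB j k : A j <= B k /\ K j <= D k.
  have [j1 _ j3 _] := mono j _ (leq_maxl j k).
  have [_ k2 _ k4] := mono k _ (leq_maxr j k).
  have [? ? _] := Bq (maxn j k).
  by split; lra.
have size_q k : (B k - A k) + (D k - K k) = ((b - a) + (d - c)) * (2^-1) ^+ k.
  elim: k => [|k IH]; first by rewrite expr0 mulr1.
  have [_ _ _ _ [-> ->]] := Sq k.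
  by rewrite exprS mulrCA -IH; lra.
(* The supremum of the left ends lies in every interval, since each left end is below each right
   end. *)
have nested (u v : nat -> R) : (forall j k, u j <= v k) ->
    exists x, forall k, u k <= x <= v k.
  move=> uv; have us : has_sup (range u).
    by split; [exists (u 0); exists 0|exists (v 0) => _ [j _ <-]].
  exists (sup (range u)) => k; apply/andP; split.
    by apply: ub_le_sup; [exact: us.2|exists k].
  by apply: ge_sup; [exact: us.1|move=> _ [j _ <-]].
have [x xP] := nested A B (fun j k => (AB j k).1).
have [y yP] := nested K D (fun j k => (AB j k).2).
have [e e0 eP] := local_P x y (xP 0) (yP 0).
have /cvgrPdist_lt/(_ e e0) : ((b - a) + (d - c)) * (2^-1 : R) ^+ k @[k --> \oo] --> (0 : R).
  rewrite -[X in _ --> X](mulr0 ((b - a) + (d - c))); apply: cvgM; first exact: cvg_cst.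
  by apply: cvg_expr; rewrite ger0_norm ?invr_ge0// invf_lt1 ?ltr1n.
move=> [k _ /(_ k (leqnn k))] /=; rewrite sub0r normrN -size_q => lte.
have [_ _ nP] := Bq k; apply: nP; apply: eP => //.
exact: le_lt_trans (ler_norm _) lte.
Qed.

End RectangleIntegral.

(** * Goursat's theorem and the Cauchy estimate *)

Section CauchyEstimate.
Variable R : realType.
Local Notation C := (Cplx R).
Implicit Types (f g h : C -> C) (z w : C) (a b c d : R).

(** [k] is the complex derivative. Multiplying the estimate of the difference quotient by [w - z]
    makes it meaningful at [w = z] too. *)
Lemma differentiable_affine_approx f z : differentiable f z ->
  exists k : C, forall e : R, 0 < e -> exists2 r : R, 0 < r &
    forall w, normc (w - z) < r ->
      normc (f w - (f z + k * (w - z))) <= e * normc (w - z).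
Proof.
move=> /derivable1_diffP; rewrite /derivable => df.
set k := lim _ in df; exists k => e e0.
have /cvgrPdist_lt/(_ (e%:C)%C) := df; rewrite ltcR => /(_ e0).
move=> /nbhs_ballP [[r r'] /=]; rewrite ltcE /= => /andP[/eqP -> r0] hr.
exists r => // w wr.
have [->|wz] := eqVneq w z; first by rewrite subrr mulr0 addr0 subrr !normc0 mulr0.
have wz0 : w - z != 0 by rewrite subr_eq0.
have wzr : ball (0 : C) (r +i* 0)%C (w - z).
  by rewrite /ball /= sub0r normrN normr_normc complexr0 ltcR.
have := hr _ wzr wz0.
rewrite /= [(w - z) *: _]mulr1 subrK normr_normc ltcR => hlt.
have -> : f w - (f z + k * (w - z)) = - ((k - (w - z)^-1 * (f w - f z)) * (w - z)).
  by field.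
rewrite normcN normcM ler_wpM2r ?normc_ge0//.
exact: ltW.
Qed.

Lemma normc_rect a b c d z w : rect a b c d z -> rect a b c d w ->
  normc (z - w) <= (b - a) + (d - c).
Proof.
move=> [/andP[? ?] /andP[? ?]] [/andP[? ?] /andP[? ?]].
apply: (le_trans (normc_le _)); rewrite ReB ImB.
by rewrite lerD// ler_norml; apply/andP; split; lra.
Qed.

(** For every [e > 0] the integral is at most [e] times the squared half perimeter. On small
    rectangles this holds because [f] is close to an affine function, whose integral vanishes;
    quadrisection carries it to the whole rectangle. *)
Lemma goursat f a b c d : a <= b -> c <= d ->
  (forall z, rect a b c d z -> differentiable f z) -> rint f a b c d = 0.
Proof.
move=> ab cd df; set p := (b - a) + (d - c).
have fc z : rect a b c d z -> {for z, continuous f}.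
  by move=> /df /differentiable_continuous.
suff key e : 0 < e -> normc (rint f a b c d) <= e * p ^+ 2.
  apply: eq0_normc; apply/eqP; rewrite eq_le normc_ge0 andbT.
  apply/ler_addgt0Pl => e e0; rewrite addr0.
  (* The rectangle may be a point, hence the division by [p ^ 2 + 1] and not by [p ^ 2]. *)
  have p1 : 0 < p ^+ 2 + 1 by rewrite ltr_wpDl ?sqr_ge0.
  apply: (le_trans (key _ (divr_gt0 e0 p1))).
  by rewrite mulrAC ler_pdivrMr// ler_wpM2l ?(ltW e0)// lerDl.
move=> e0.
(* Inclusion in the given rectangle is a premise within [P], because [quadrisection] ranges over all
   rectangles. *)
pose P a' b' c' d' := a <= a' -> b' <= b -> c <= c' -> d' <= d ->
  a' <= b' -> c' <= d' -> 
  normc (rint f a' b' c' d') <= e * ((b' - a') + (d' - c')) ^+ 2.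
suff : P a b c d by apply.
have contf a' b' c' d' : a <= a' -> b' <= b -> c <= c' -> d' <= d ->
    continuous_frame f a' b' c' d'.
  by move=> ? ? ? ? z [zr _]; apply: fc; apply: rectS zr.
apply: quadrisection => // [{}a' b' c' d' ab' cd'|x y xab ycd].
  set m := (a' + b') / 2; set l := (c' + d') / 2 => P1 P2 P3 P4 aa bb cc dd _ _.
  have am : a' <= m by rewrite /m; lra.
  have mb : m <= b' by rewrite /m; lra.
  have cl : c' <= l by rewrite /l; lra.
  have ld : l <= d' by rewrite /l; lra.
  have -> : rint f a' b' c' d' = rint f a' m c' l + rint f a' m l d'
      + (rint f m b' c' l + rint f m b' l d').
    rewrite (@rint_splitx _ f _ _ _ _ m) ?am ?mb//; last exact: contf.
    by rewrite !(@rint_splity _ f _ _ c' d' l) ?cl ?ld//; apply: contf; lra.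
  (* Each quarter has half the half perimeter, so four squares add up to the square for the whole:
     the bound is additive. *)
  have e4 : (b' - a' + (d' - c')) ^+ 2 = (m - a' + (l - c')) ^+ 2
      + (m - a' + (d' - l)) ^+ 2 + ((b' - m + (l - c')) ^+ 2 + (b' - m + (d' - l)) ^+ 2).
    by rewrite /m /l; field.
  rewrite e4 !mulrDr.
  apply: (le_trans (normcD _ _)); apply: lerD;
    (apply: (le_trans (normcD _ _)); apply: lerD).
  - by apply: P1 => //; lra.
  - by apply: P2 => //; lra.
  - by apply: P3 => //; lra.
  - by apply: P4 => //; lra.
(* The quarter compensates the factor 4 of [normc_rint]. *)
have [k /(_ (e / 4)) []] := differentiable_affine_approx (df (x +i* y)%C (conj xab ycd)).
  by rewrite divr_gt0.
move=> r r0 kr; exists r => // a' b' c' d' xab' ycd' small aa bb cc dd ab' cd'.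
set z0 : C := (x +i* y)%C.
(* The affine approximation of [f] at [z0]; subtracting it does not change the integral. *)
pose A := fun w : C => (f z0 - k * z0) + k * w.
have -> : rint f a' b' c' d' = rint (fun w => f w - A w) a' b' c' d'.
  rewrite rintB//; [by rewrite rint_affine// subr0|exact: contf|].
  by move=> w _; exact: continuous_affine.
set q := (b' - a') + (d' - c').
have q0 : 0 <= q by rewrite /q; lra.
have -> : e * q ^+ 2 = 4 * (e / 4 * q) * q by field.
apply: normc_rint => //.
  move=> w wf; apply: continuousB; first exact: (contf a' b' c' d').
  exact: continuous_affine.
move=> w [wr _].
have wq : normc (w - z0) <= q by apply: (normc_rect wr); split.
have -> : f w - A w = f w - (f z0 + k * (w - z0)) by rewrite /A; ring.
apply: le_trans (kr w (le_lt_trans wq small)) _.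
by rewrite ler_wpM2l// divr_ge0// ltW.
Qed.

(** By Goursat's theorem the rectangle can be replaced by a small square about [w]. There [f] is
    bounded, so the integral is of the order of the side of the square. *)
Lemma rint_eq0_punctured f w a b c d (K r : R) :
  a < Re w < b -> c < Im w < d -> 0 < r ->
  (forall z, rect a b c d z -> z != w -> differentiable f z) ->
  (forall z, normc (z - w) < r -> z != w -> normc (f z) <= K) ->
  rint f a b c d = 0.
Proof.
move=> /andP[aw wb] /andP[cw wd] r0 df fK.
have contf a' b' c' d' : a <= a' -> b' <= b -> c <= c' -> d' <= d ->
    ~ frame a' b' c' d' w -> continuous_frame f a' b' c' d'.
  move=> ? ? ? ? nw z zf; apply: differentiable_continuous; apply: df.
    by case: zf => zr _; apply: rectS zr.
  by apply/eqP => zw; apply: nw; rewrite -zw.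
(* A half side [t < s] keeps the square off the sides of the rectangle and, as [2 t < r], inside the
   disc where [f] is bounded. *)
pose s := Num.min (Num.min (Re w - a) (b - Re w))
  (Num.min (Num.min (Im w - c) (d - Im w)) (r / 2)).
have s0 : 0 < s by rewrite !lt_min; do !(apply/andP; split); lra.
have small t : 0 < t -> t < s -> normc (rint f a b c d) <= 16 * (`|K| + 1) * t.
  move=> t0; rewrite !lt_min => /andP[/andP[t1 t2] /andP[/andP[t3 t4] t5]].
  have zero a' b' c' d' : a <= a' -> b' <= b -> c <= c' -> d' <= d ->
      a' <= b' -> c' <= d' -> ~ rect a' b' c' d' w -> rint f a' b' c' d' = 0.
    move=> ? ? ? ? ? ? nw; apply: goursat => // z zr; apply: df.
      exact: rectS zr.
    by apply/eqP => zw; apply: nw; rewrite -zw.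
  (* The left, right, lower and upper strips around the square do not contain [w], so each has
     integral zero and can be cut off. *)
  have -> : rint f a b c d = rint f (Re w - t) (Re w + t) (Im w - t) (Im w + t).
    have z1 : rint f a (Re w - t) c d = 0.
      by apply: zero; [lra..|move=> -[/andP[? ?] _]; lra].
    have z2 : rint f (Re w + t) b c d = 0.
      by apply: zero; [lra..|move=> -[/andP[? ?] _]; lra].
    have z3 : rint f (Re w - t) (Re w + t) c (Im w - t) = 0.
      by apply: zero; [lra..|move=> -[_ /andP[? ?]]; lra].
    have z4 : rint f (Re w - t) (Re w + t) (Im w + t) d = 0.
      by apply: zero; [lra..|move=> -[_ /andP[? ?]]; lra].
    rewrite (@rint_splitx _ f a b c d (Re w - t)); first last.
    - by apply: contf; [lra..|move=> -[_ []]; lra].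
    - lra.
    - by apply/andP; split; lra.
    rewrite z1 add0r (@rint_splitx _ f (Re w - t) b c d (Re w + t)); first last.
    - by apply: contf; [lra..|move=> -[_ []]; lra].
    - lra.
    - by apply/andP; split; lra.
    rewrite z2 addr0 (@rint_splity _ f _ _ c d (Im w - t)); first last.
    - by apply: contf; [lra..|move=> -[_ []]; lra].
    - by apply/andP; split; lra.
    - lra.
    rewrite z3 add0r (@rint_splity _ f _ _ (Im w - t) d (Im w + t)); first last.
    - by apply: contf; [lra..|move=> -[_ []]; lra].
    - by apply/andP; split; lra.
    - lra.
    by rewrite z4 addr0.
  have -> : 16 * (`|K| + 1) * t
      = 4 * (`|K| + 1) * ((Re w + t - (Re w - t)) + (Im w + t - (Im w - t))) by ring.
  apply: normc_rint; [lra|lra| |].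
    by apply: contf; [lra..|move=> -[_ []]; lra].
  move=> z zf; apply: (@le_trans _ _ K); last first.
    by have := ler_norm K; lra.
  apply: fK.
    apply: le_lt_trans (normc_le _) _; rewrite ReB ImB.
    case: zf => -[/andP[? ?] /andP[? ?]] _.
    have : `|Re z - Re w| <= t by rewrite ler_norml; apply/andP; split; lra.
    have : `|Im z - Im w| <= t by rewrite ler_norml; apply/andP; split; lra.
    lra.
  by apply/eqP => zw; move: zf; rewrite zw => -[_ []]; lra.
apply: eq0_normc; apply/eqP; rewrite eq_le normc_ge0 andbT.
apply/ler_addgt0Pl => e e0; rewrite addr0.
have K1 : 0 < 16 * (`|K| + 1) by rewrite mulr_gt0// ltr_wpDl.
pose t := Num.min (s / 2) (e / (16 * (`|K| + 1))).
have t0 : 0 < t by rewrite lt_min !divr_gt0.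
have ts : t < s by rewrite gt_min ltr_pdivrMr// ltr_pMr// ltr1n.
apply: (le_trans (small t t0 ts)).
by rewrite mulrC -ler_pdivlMr// ge_min lexx orbT.
Qed.

Lemma Re_invc z : Re z^-1 = Re z / (Re z ^+ 2 + Im z ^+ 2).
Proof. by case: z. Qed.

Lemma Im_invc z : Im z^-1 = - (Im z / (Re z ^+ 2 + Im z ^+ 2)).
Proof. by case: z. Qed.

Lemma differentiable_kernel z w : z != w -> differentiable (fun u : C => (u - w)^-1) z.
Proof.
move=> zw; apply: differentiableV; last by rewrite subr_eq0.
by apply: differentiableB.
Qed.

(** The value is [2 pi i], but nonvanishing suffices. After multiplication by [- i] every side
    contributes a nonnegative real part, and the right side a positive one. *)
Lemma rint_kernel_neq0 w a b c d : a < Re w < b -> c < Im w < d ->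
  rint (fun z => (z - w)^-1) a b c d != 0.
Proof.
move=> /andP[aw wb] /andP[cw wd].
have ab : a < b by lra. have cd : c < d by lra.
have kc : continuous_frame (fun z => (z - w)^-1) a b c d.
  move=> z [_ zf]; apply: differentiable_continuous; apply: differentiable_kernel.
  by apply/eqP => zw; move: zf; rewrite zw => -[]; lra.
have [k1 k2 k3 k4] := continuous_frameP (ltW ab) (ltW cd) kc.
apply/eqP => I0.
pose J := rint (fun z => (z - w)^-1) a b c d.
have JE : - 'i%C * J =
    cint (fun x => - 'i%C * ((x +i* c)%C - w)^-1) a b
    + cint (fun y => ((b +i* y)%C - w)^-1) c d
    + cint (fun x => 'i%C * ((x +i* d)%C - w)^-1) a b
    + cint (fun y => -1 * ((a +i* y)%C - w)^-1) c d.
  have i2 : 'i%C * 'i%C = -1 :> C by rewrite -expr2; exact: sqr_i.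
  rewrite (cintZ _ k1) (cintZ _ k2) (cintZ _ k3) /J /rint.
  set u1 := cint _ a b; set u2 := cint _ c d; set u3 := cint _ a b; set u4 := cint _ c d.
  have -> : - 'i%C * (u1 + 'i%C * u2 - u3 - 'i%C * u4)
     = - 'i%C * u1 - ('i%C * 'i%C) * u2 + 'i%C * u3 + ('i%C * 'i%C) * u4 :> C by ring.
  by rewrite i2; ring.
have : Re (- 'i%C * J) = 0 by rewrite /J I0 mulr0.
rewrite JE !ReD.
have sc (k : C) (phi : R -> C) s t : continuous_on phi s t ->
    continuous_on (fun x => k * phi x) s t.
  by move=> h x xst; apply: continuousM; [exact: cst_continuous|exact: h].
have h1 := @Re_cint_ge _ _ a b 0 (ltW ab) (sc (- 'i%C) _ _ _ k1).
have h3 := @Re_cint_ge _ _ a b 0 (ltW ab) (sc ('i%C) _ _ _ k2).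
have h4 := @Re_cint_ge _ _ c d 0 (ltW cd) (sc (-1) _ _ _ k3).
(* A lower bound for the real part of the kernel on the right side, where the imaginary distance to
   [w] is at most [d - c]. *)
pose m := (b - Re w) / ((b - Re w) ^+ 2 + (d - c) ^+ 2).
have N0 : 0 < (b - Re w) ^+ 2 + (d - c) ^+ 2.
  by rewrite ltr_pwDl ?sqr_ge0// exprn_gt0// subr_gt0.
have m0 : 0 < m by rewrite /m divr_gt0// subr_gt0.
have h2 := @Re_cint_ge _ _ c d m (ltW cd) k4.
have mcd : 0 < m * (d - c) by rewrite mulr_gt0// subr_gt0.
move: h1 h2 h3 h4; rewrite !mul0r => h1 h2 h3 h4.
have sq (x y : R) : 0 <= x ^+ 2 + y ^+ 2 by rewrite addr_ge0 ?sqr_ge0.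
have {}h1 := h1 _; have {}h3 := h3 _; have {}h4 := h4 _; have {}h2 := h2 _.
suff [g1 g2 g3 g4] : [/\ forall t, a <= t <= b -> 0 <= Re (- 'i%C * ((t +i* c)%C - w)^-1),
    forall t, c <= t <= d -> m <= Re (((b +i* t)%C - w)^-1),
    forall t, a <= t <= b -> 0 <= Re ('i%C * ((t +i* d)%C - w)^-1)
  & forall t, c <= t <= d -> 0 <= Re (-1 * ((a +i* t)%C - w)^-1)].
  by move: (h1 g1) (h2 g2) (h3 g3) (h4 g4); clear -mcd; lra.
split=> t /andP[t1 t2].
- rewrite Re_mulc Re_invc Im_invc ReB ImB /= !oppr0 mul0r sub0r mulN1r opprK -mulNr.
  by rewrite divr_ge0//; lra.
- rewrite Re_invc ReB ImB /= /m ler_wpM2l//; first lra.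
  rewrite lef_pV2 ?posrE//; last first.
    by rewrite ltr_pwDl ?sqr_ge0// exprn_gt0// subr_gt0.
  rewrite lerD2l -subr_ge0 subr_sqr; clear -t1 t2 cw wd.
  by rewrite mulr_ge0//; lra.
- rewrite Re_mulc Re_invc Im_invc ReB ImB /= mul0r sub0r mul1r opprK.
  by rewrite divr_ge0//; lra.
- rewrite mulN1r raddfN /= Re_invc ReB ImB /= -mulNr.
  by rewrite divr_ge0//; lra.
Qed.

(** The quotient [(g z - g w) / (z - w)] is bounded near [w], so its integral vanishes and [g w]
    times the kernel integral equals the integral of [g z / (z - w)]. [K] is independent of [g],
    which allows applying one [K] to a whole sequence of functions. *)
Lemma cauchy_estimate w a b c d : a < Re w < b -> c < Im w < d ->
  exists2 K : R, 0 <= K & forall g (M : R),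
    (forall z, rect a b c d z -> differentiable g z) ->
    (forall z, frame a b c d z -> normc (g z) <= M) ->
    normc (g w) <= K * M.
Proof.
move=> wab wcd; have I0 := rint_kernel_neq0 wab wcd.
set k := fun z => _ in I0; set I := rint k a b c d in I0.
have /andP[aw wb] := wab; have /andP[cw wd] := wcd.
have ab : a <= b by lra. have cd : c <= d by lra.
(* A lower bound for the distance from [w] to the frame. *)
pose m := Num.min (Num.min (Re w - a) (b - Re w)) (Num.min (Im w - c) (d - Im w)).
have m0 : 0 < m by rewrite !lt_min; do !(apply/andP; split); lra.
have km z : frame a b c d z -> normc (k z) <= m^-1.
  move=> [_ zf]; rewrite /k normcV.
  have mz : m <= normc (z - w).
    case: zf => zf.
    - apply: le_trans (Re_le_normc _); rewrite ReB zf /m ler_normr !ge_min.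
      by apply/orP; right; rewrite opprB lexx.
    - apply: le_trans (Re_le_normc _); rewrite ReB zf /m ler_normr !ge_min.
      by apply/orP; left; rewrite lexx !orbT.
    - apply: le_trans (Im_le_normc _); rewrite ImB zf /m ler_normr !ge_min.
      by apply/orP; right; rewrite opprB lexx !orbT.
    - apply: le_trans (Im_le_normc _); rewrite ImB zf /m ler_normr !ge_min.
      by apply/orP; left; rewrite lexx !orbT.
  by rewrite lef_pV2 ?posrE// (lt_le_trans m0).
have nI : 0 < normc I by rewrite normc_gt0.
set p := (b - a) + (d - c); have p0 : 0 <= p by rewrite /p; lra.
exists (4 * m^-1 * p / normc I).
  by rewrite !mulr_ge0 ?invr_ge0 ?normc_ge0// ltW.
move=> g M dg gM.
have wr : rect a b c d w by split; apply/andP; split; exact: ltW.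
have nw z : frame a b c d z -> z != w.
  by move=> [_ zf]; apply/eqP => zw; move: zf; rewrite zw => -[]; lra.
have ck : continuous_frame k a b c d.
  by move=> z /nw zw; apply: differentiable_continuous; exact: differentiable_kernel.
have cg : continuous_frame g a b c d.
  by move=> z [zr _]; apply: differentiable_continuous; exact: dg.
have cgk : continuous_frame (fun z => g z * k z) a b c d.
  by move=> z zf; apply: continuousM; [exact: cg|exact: ck].
have cwk : continuous_frame (fun z => g w * k z) a b c d.
  by move=> z zf; apply: continuousM; [exact: cst_continuous|exact: ck].
(* With tolerance 1 in the affine approximation at [w], the quotient is bounded by [normc l + 1]
   near [w], where [l] is the derivative. *)
have zero : rint (fun z => g z * k z - g w * k z) a b c d = 0.
  have [l /(_ 1 ltr01) [r r0 lr]] := differentiable_affine_approx (dg w wr).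
  apply: (rint_eq0_punctured (K := normc l + 1) wab wcd r0) => z zr zw.
    have dk := differentiable_kernel zw.
    apply: differentiableB; apply: differentiableM.
    + exact: dg.
    + exact: dk.
    + exact: differentiable_cst.
    + exact: dk.
  have zw0 : z - w != 0 by rewrite subr_eq0.
  have -> : g z * k z - g w * k z
     = (g z - (g w + l * (z - w))) * (z - w)^-1 + l by rewrite /k; field.
  apply: (le_trans (normcD _ _)); rewrite addrC lerD2l normcM normcV.
  rewrite ler_pdivrMr ?normc_gt0//.
  exact: lr.
have {}zero : rint (fun z => g z * k z) a b c d = g w * I.
  by apply/eqP; rewrite -subr_eq0 /I -rintZ// -rintB// zero.
have M0 : 0 <= M.
  apply: le_trans (normc_ge0 (g (a +i* c)%C)) (gM _ _).
  by split; [split; rewrite /= lexx|exact: Or41].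
have : normc (g w * I) <= 4 * (M * m^-1) * p.
  rewrite -zero; apply: normc_rint => // z zf.
  by rewrite normcM; apply: ler_pM; rewrite ?normc_ge0//; [exact: gM|exact: km].
rewrite normcM -ler_pdivlMr// => /le_trans; apply.
by rewrite le_eqVlt; apply/orP; left; apply/eqP; ring.
Qed.

End CauchyEstimate.

Lemma differentiable_expr (K : numFieldType) (V : normedModType K) (f : V -> K) v k :
  differentiable f v -> differentiable (fun u => f u ^+ k) v.
Proof.
move=> df; elim: k => [|k IH]; first exact: differentiable_cst.
have -> : (fun u => f u ^+ k.+1) = (fun u => f u * f u ^+ k).
  by apply/funext => u; rewrite exprS.
exact: differentiableM.
Qed.

(** * Functions of one variable that vanish near the origin *)

Section VanishingNearPoint.
Variable R : realType.
Local Notation C := (Cplx R).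
Implicit Types (f : C -> C) (z w : C) (a b c d : R).

Lemma normc_continuous : continuous (@normc R : C -> R).
Proof.
move=> z; apply: (@continuous_comp _ _ _ (fun u : C => `|u|) (@complex.Re R)).
  exact: norm_continuous.
exact: Re_continuous.
Qed.

Lemma continuous_on_bounded (phi : R -> C) a b : a <= b -> continuous_on phi a b ->
  exists M : R, forall t, a <= t <= b -> normc (phi t) <= M.
Proof.
move=> ab h.
have h2 : {within `[a, b], continuous (fun t => normc (phi t))}.
  apply: continuous_in_subspaceT => t /set_mem /=; rewrite in_itv /= => abt.
  by apply: (continuous_comp (h _ abt)); exact: normc_continuous.
have [c _ cP] := EVT_max ab h2.
by exists (normc (phi c)) => t abt; apply: cP; rewrite in_itv.
Qed.

Lemma continuous_frame_bounded f a b c d : a <= b -> c <= d ->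
  continuous_frame f a b c d ->
  exists M : R, forall z, frame a b c d z -> normc (f z) <= M.
Proof.
move=> ab cd /(continuous_frameP ab cd)[].
move=> /(continuous_on_bounded ab)[M1 h1] /(continuous_on_bounded ab)[M2 h2].
move=> /(continuous_on_bounded cd)[M3 h3] /(continuous_on_bounded cd)[M4 h4].
exists (Num.max (Num.max M1 M2) (Num.max M3 M4)) => -[x y] [[/= hx hy] zf].
rewrite !le_max; case: zf => /= zE; subst.
- by rewrite h3 ?orbT.
- by rewrite h4 ?orbT.
- by rewrite h1.
- by rewrite h2 ?orbT.
Qed.

Lemma differentiable_near_eq0 f (r : R) z : 0 < r ->
  (forall u, normc (u - z) < r -> f u = 0) -> differentiable f z.
Proof.
move=> r0 h; apply/derivable1_diffP.
apply: (@near_eq_derivable _ _ _ (cst 0)).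
  apply/nbhs_ballP; exists (r%:C)%C; first by rewrite /= ltcR.
  move=> u; rewrite /ball /= distrC normr_normc ltcR => zu.
  by rewrite h.
exact: derivable_cst.
Qed.

(* The Cauchy estimate for [f z / z ^ N] bounds [|f w|] by [K M (|w| / s) ^ N]. *)
Lemma eq0_near_eq0_square f (s r : R) w : 0 < r ->
  (forall z, rect (- s) s (- s) s z -> differentiable f z) ->
  (forall z, normc z < r -> f z = 0) ->
  normc w < s -> f w = 0.
Proof.
move=> r0 df f0 ws.
have s0 : 0 < s by apply: le_lt_trans ws; exact: normc_ge0.
have [->|w0] := eqVneq w 0; first by apply: f0; rewrite normc0.
have Rews : - s < Re w < s by rewrite -ltr_norml (le_lt_trans (Re_le_normc _)).
have Imws : - s < Im w < s by rewrite -ltr_norml (le_lt_trans (Im_le_normc _)).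
have [K K0 estimate] := cauchy_estimate Rews Imws.
have ss : - s <= s by lra.
have [M fM] : exists M, forall z, frame (- s) s (- s) s z -> normc (f z) <= M.
  apply: continuous_frame_bounded => // z [zr _].
  exact: differentiable_continuous (df z zr).
have M0 : 0 <= M.
  apply: le_trans (normc_ge0 (f ((- s) +i* (- s))%C)) (fM _ _).
  by split; [split; rewrite /= lexx|exact: Or41].
have bound N : normc (f w) <= K * M * (normc w / s) ^+ N.
  pose g z := f z * (z^-1) ^+ N.
  have : normc (g w) <= K * (M * (s^-1) ^+ N).
    apply: estimate => z.
      (* At 0 the power of [z^-1] does no harm: [f], and with it [g], vanishes on a
         neighbourhood. *)
      move=> zr; have [->|z0] := eqVneq z 0.
        apply: (differentiable_near_eq0 r0) => u.
        by rewrite subr0 /g => /f0 ->; rewrite mul0r.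
      apply: differentiableM; first exact: df.
      exact/differentiable_expr/differentiableV.
    move=> zf; have sz : s <= normc z.
      case: zf => _ [] zs.
      - by apply: le_trans (Re_le_normc _); rewrite zs normrN ger0_norm// ltW.
      - by apply: le_trans (Re_le_normc _); rewrite zs ger0_norm// ltW.
      - by apply: le_trans (Im_le_normc _); rewrite zs normrN ger0_norm// ltW.
      - by apply: le_trans (Im_le_normc _); rewrite zs ger0_norm// ltW.
    rewrite /g normcM normcX normcV.
    apply: ler_pM; rewrite ?exprn_ge0 ?invr_ge0 ?normc_ge0//.
      exact: fM.
    rewrite lerXn2r ?nnegrE ?invr_ge0 ?normc_ge0 ?(ltW s0)//.
    by rewrite lef_pV2 ?posrE// (lt_le_trans s0).
  have nw : 0 < normc w by rewrite normc_gt0.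
  rewrite /g normcM normcX normcV !exprVn ler_pdivrMr ?exprn_gt0// => /le_trans; apply.
  by rewrite expr_div_n !mulrA le_eqVlt; apply/orP; left; apply/eqP; ring.
apply: eq0_normc; apply: contrapT => /eqP fw.
have fw0 : 0 < normc (f w) by rewrite lt_neqAle eq_sym fw normc_ge0.
(* As [normc w < s], the bound tends to 0 with growing [N] and falls below [normc (f w)]. *)
have /cvgrPdist_lt/(_ _ fw0) : K * M * (normc w / s) ^+ N @[N --> \oo] --> (0 : R).
  rewrite -[X in _ --> X](mulr0 (K * M)); apply: cvgM; first exact: cvg_cst.
  apply: cvg_expr; rewrite ger0_norm ?divr_ge0 ?normc_ge0 ?ltW//.
  by rewrite ltr_pdivrMr// mul1r.
move=> [N _ /(_ N (leqnn N))] /=; rewrite sub0r normrN => lte.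
by have := lt_le_trans (le_lt_trans (ler_norm _) lte) (bound N); rewrite ltxx.
Qed.

End VanishingNearPoint.

(** * Unique continuation *)

Section UniqueContinuation.
Variables (R : realType) (n : nat).
Local Notation C := (Cplx R).
Implicit Types (U V W : set 'rV[C]_n) (f g h q : 'rV[C]_n -> C).

Lemma near_dist_lt f z (e : C) : {for z, continuous f} -> 0 < e ->
  \forall y \near z, `|f z - f y| < e.
Proof.
by move=> fc; exact: (@cvgrPdist_lt _ _ _ _ (nbhs_filter z) f (f z)).1 fc e.
Qed.

(* The square [|Re t|, |Im t| <= 2] is sent by [t |-> u + t (z - u)] within [9 r]
   of [v], and its inscribed disc contains [t = 1]. *)
Lemma eq0_near_eq0_ball h (v u : 'rV[C]_n) (r : C) : 0 < r ->
  (forall z, `|z - v| < 10 * r -> differentiable h z) ->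
  `|u - v| < r -> (\forall z \near u, h z = 0) ->
  forall z, `|z - v| < r -> h z = 0.
Proof.
move=> r0 dh uv /nbhs_ballP[e /= e0 ue] z zv.
have zu : `|z - u| < 2 * r.
  have -> : z - u = (z - v) - (u - v) by rewrite opprB addrA subrK.
  by rewrite (le_lt_trans (ler_normB _ _))// mulr_natl mulr2n ltrD.
pose f (t : C) := h (u + t *: (z - u)).
have -> : h z = f 1 by rewrite /f scale1r addrC subrK.
(* [|t| < e / (2 r)] keeps the point of the line within [e] of [u], because [|z - u| < 2 r]. *)
have er0 : 0 < e / (2 * r) by rewrite divr_gt0// mulr_gt0.
have er : ((Re (e / (2 * r)))%:C)%C = e / (2 * r) :> C.
  by apply: RRe_real; rewrite realE ltW.
apply: (@eq0_near_eq0_square R f 2 (Re (e / (2 * r)))).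
- by rewrite -ltcR er.
- move=> t [/andP[t1 t2] /andP[t3 t4]].
  have t5 : `|t| <= 4.
    rewrite normr_normc.
    have -> : 4 = ((4 : R)%:C)%C :> C by rewrite rmorph_nat.
    rewrite lecR (le_trans (normc_le _))//.
    have : `|Re t| <= 2 by rewrite ler_norml t1 t2.
    have : `|Im t| <= 2 by rewrite ler_norml t3 t4.
    lra.
  apply: (@differentiable_comp _ _ _ _ (fun t : C => u + t *: (z - u)) h).
    apply: differentiableD; first exact: differentiable_cst.
    by apply: differentiableZl.
  apply: dh.
  have -> : u + t *: (z - u) - v = (u - v) + t *: (z - u).
    by rewrite addrAC.
  apply: (le_lt_trans (ler_normD _ _)); rewrite mx_normZ.
  have -> : 10 * r = r + 9 * r by ring.
  apply: (ltr_leD uv); apply: (@le_trans _ _ (4 * (2 * r))).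
    by apply: ler_pM => //; exact: ltW.
  by rewrite mulrA -natrM ler_wpM2r ?ler_nat// ltW.
- move=> t; rewrite -ltcR -normr_normc er => te.
  apply: ue; rewrite -ball_normE /ball_ /= opprD addrA subrr sub0r normrN mx_normZ.
  have [->|tn] := eqVneq (`|t|) 0; first by rewrite mul0r.
  apply: (@lt_trans _ _ (`|t| * (2 * r))).
    by rewrite ltr_pM2l// lt_neqAle eq_sym tn normr_ge0.
  by rewrite -ltr_pdivlMr// mulr_gt0.
- by rewrite normc1 ltr1n.
Qed.

(* The points near which every such [h] vanishes form an open subset of [V];
   were it also closed in [V], it would be all of [V], whence [V `<=` W]. *)
Lemma exists_boundary_point U V W : open U -> U !=set0 -> U `<=` W `&` V ->
  open W -> open V -> connected V -> ~ (V `<=` W) ->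
  exists p, [/\ V p, ~ W p & forall h, holomorphic (W `&` V) h ->
    (forall z, U z -> h z = 0) -> closure [set z | (W `&` V) z /\ h z = 0] p].
Proof.
move=> oU [u0 Uu0] UWV oW oV cV VW; apply: contrapT => nop; apply: VW.
have oWV : open (W `&` V) by exact: openI.
(* All [h] are treated at once, so that [p] can be found before [h]: the function used later depends
   on [p]. *)
pose B := [set z | (W `&` V) z /\ forall h, holomorphic (W `&` V) h ->
  (forall z, U z -> h z = 0) -> \forall y \near z, h y = 0].
have room z : (W `&` V) z -> exists2 r : C, 0 < r &
    forall y, `|y - z| < 10 * r -> (W `&` V) y.
  move=> WVz; have /nbhs_ballP[e /= e0 ze] := open_nbhs_nbhs (conj oWV WVz).
  exists (e / 10); first by rewrite divr_gt0.
  move=> y; rewrite mulrC divfK ?pnatr_eq0// => yz.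
  by apply: ze; rewrite -ball_normE /ball_ /= distrC.
have BV : B `<=` V by move=> z [[]].
have oB : open B.
  rewrite openE => z [WVz Bz]; have [r r0 rz] := room z WVz.
  have zr : \forall y \near z, ball z r y by exact: nbhsx_ballx.
  have zWV := open_nbhs_nbhs (conj oWV WVz).
  have zN := @near_join _ z _ zr.
  apply: (@filterS _ (nbhs z) _ _ _ _ (filterI zWV zN)) => y [WVy yr].
  split; first exact: WVy.
  move=> h hh hU.
  apply: filterS yr => y' y'r.
  apply: (@eq0_near_eq0_ball h z z r r0) => //.
  - by move=> x /rz; exact: hh.
  - by rewrite subrr normr0.
  - exact: Bz.
  - by move: y'r; rewrite -ball_normE /ball_ /= distrC.
have clB : V `&` closure B `<=` B.
  move=> z [Vz clz].
  (* Outside [W], the point [z] would be a [p] as required, since every [h] vanishes on [B]. *)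
  have Wz : W z.
    apply: contrapT => nWz; apply: nop; exists z; split=> // h hh hU.
    apply: (closure_subset _ clz) => y [WVy yB]; split=> //.
    exact: nbhs_singleton (yB h hh hU).
  have [r r0 rz] := room z (conj Wz Vz).
  have [u [[WVu Bu] ur]] := clz _ (nbhsx_ballx z r r0).
  split; first by split.
  move=> h hh hU; apply: (@filterS _ (nbhs z) _ _ _ _ (nbhsx_ballx z r r0)) => y yr.
  apply: (@eq0_near_eq0_ball h z u r r0) => //.
  - by move=> x /rz; exact: hh.
  - by move: ur; rewrite -ball_normE /ball_ /= distrC.
  - exact: Bu.
  - by move: yr; rewrite -ball_normE /ball_ /= distrC.
(* [B] is nonempty, open and closed in the connected set [V]. *)
have BVE : B = V.
  apply: cV.
  - exists u0; split; first exact: UWV.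
    move=> h _ hU; apply: filterS (open_nbhs_nbhs (conj oU Uu0)) => y.
    exact: hU.
  - by exists B => //; rewrite setIidr.
  - exists (closure B); first exact: closed_closure.
    apply/seteqP; split=> // z Bz; split; first exact: BV.
    exact: subset_closure.
by rewrite -BVE => z [[]].
Qed.

(** [q] is a barrier at [p]: an extension of [1 / q] across [p] would be inverse to [q] at points
    arbitrarily close to [p], which is impossible as [q] tends to 0 there. *)
Lemma domain_of_holomorphyP W : domain W ->
  (forall p, closure W p -> ~ W p -> exists q,
     [/\ holomorphic W q, forall z, W z -> q z != 0,
         {for p, continuous q} & q p = 0]) ->
  domain_of_holomorphy W.
Proof.
move=> dW barrier; split=> //; case: dW => oW _ _.
move=> [U [V [[oU U0 UWV] [[oV cV VW] ext]]]].
have [p [Vp nWp pP]] := exists_boundary_point oU U0 UWV oW oV cV VW.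
have clWp : closure W p.
  (* For the zero function, the property of [p] says that [p] is in the closure of [W]. *)
  have hc0 : holomorphic (W `&` V) (cst 0 : 'rV[C]_n -> C).
    by move=> z _; exact: differentiable_cst.
  by apply: (closure_subset _ (pP _ hc0 (fun _ _ => erefl))) => z [[]].
have [q [hq q0 cq qp]] := barrier p clWp nWp.
have [g [hg Ug]] := ext (fun z => (q z)^-1)
  (fun z Wz => differentiableV (hq z Wz) (q0 z Wz)).
(* [h] vanishes on [U], so its zeros accumulate at [p], although [h p = -1]. *)
pose h : 'rV[C]_n -> C := fun z => g z * q z - 1.
have /pP : holomorphic (W `&` V) h.
  move=> z [Wz Vz]; apply: differentiableB; last exact: differentiable_cst.
  by apply: differentiableM; [exact: hg|exact: hq].
have hU z : U z -> h z = 0.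
  by move=> Uz; rewrite /h -Ug// mulVf ?subrr// q0//; case: (UWV z Uz).
move=> /(_ hU) clh.
have ch : {for p, continuous h}.
  have cg : {for p, continuous g} by apply: differentiable_continuous; exact: hg.
  have cgq : {for p, continuous (g \* q)} by exact (@continuousM C 'rV[C]_n g q p cg cq).
  have c1 : {for p, continuous (cst 1 : 'rV[C]_n -> C)} by exact: cst_continuous.
  exact (@continuousB C C 'rV[C]_n _ _ _ cgq c1).
have hp : h p = -1 by rewrite /h qp mulr0 sub0r.
have hN := near_dist_lt ch ltr01.
have [z [[_ hz] zb]] := clh _ hN.
by move: zb; rewrite hz subr0 hp normrN1 ltxx.
Qed.

End UniqueContinuation.

(** * Polynomials with nonnegative coefficients *)

Section NonnegativePolynomials.
Variables (R : realType) (n : nat).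
Local Notation C := (Cplx R).
Variable p : mpoly n C.
Hypothesis p_ge0 : forall m, 0 <= mcoeff m p.
Implicit Types (x y a b : 'I_n -> C).

(** Used with [D] the continuity, and then the complex differentiability, at a point. *)
Lemma meval_closed (T : Type) (D : (T -> C) -> Prop) (x : T -> 'I_n -> C) :
  (forall c, D (fun=> c)) ->
  (forall f g, D f -> D g -> D (fun t => f t + g t)) ->
  (forall f g, D f -> D g -> D (fun t => f t * g t)) ->
  (forall i, D (fun t => x t i)) -> D (fun t => meval (x t) p).
Proof.
move=> Dc DD DM Dx.
have -> : (fun t => meval (x t) p)
    = (fun t => \sum_(m <- msupp p) mcoeff m p * \prod_i x t i ^+ m i).
  by apply/funext => t; rewrite mevalE.
have DX f k : D f -> D (fun t => f t ^+ k).
  move=> Df; elim: k => [|k IH]; first exact: (Dc 1).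
  have -> : (fun t => f t ^+ k.+1) = (fun t => f t * f t ^+ k).
    by apply/funext => t; rewrite exprS.
  exact: (DM _ _ Df IH).
elim: (msupp p : seq _) => [|m s IH].
  rewrite (_ : (fun t => _) = fun=> 0); first exact: Dc.
  by apply/funext => t; rewrite big_nil.
rewrite (_ : (fun t => _) = fun t => mcoeff m p * \prod_i x t i ^+ m i
    + \sum_(m <- s) mcoeff m p * \prod_i x t i ^+ m i); last first.
  by apply/funext => t; rewrite big_cons.
apply: (DD _ _ _ IH); apply: (DM _ _ _ _); first exact: Dc.
elim: (index_enum _) => [|i r IHr].
  rewrite (_ : (fun t => _) = fun=> 1); first exact: Dc.
  by apply/funext => t; rewrite big_nil.
rewrite (_ : (fun t => _) = fun t => x t i ^+ m i * \prod_(i <- r) x t i ^+ m i).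
  exact: (DM _ _ (DX _ _ (Dx i)) IHr).
by apply/funext => t; rewrite big_cons.
Qed.

Lemma meval_ge0 x : (forall i, 0 <= x i) -> 0 <= meval x p.
Proof.
move=> x0; rewrite mevalE sumr_ge0// => m _.
by rewrite mulr_ge0// prodr_ge0// => i _; rewrite exprn_ge0.
Qed.

Lemma ler_meval x y : (forall i, 0 <= x i <= y i) -> meval x p <= meval y p.
Proof.
move=> xy; rewrite !mevalE ler_sum// => m _; rewrite ler_wpM2l// ler_prod// => i _.
case/andP: (xy i) => x0 xyi.
by rewrite exprn_ge0// lerXn2r// nnegrE// (le_trans x0).
Qed.

(** Without constant term every monomial has positive degree [k], and [s ^ k <= s]. *)
Lemma meval_scale_le (s : C) x : mcoeff mnm0 p = 0 -> 0 <= s <= 1 ->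
  (forall i, 0 <= x i) -> meval (fun i => s * x i) p <= s * meval x p.
Proof.
move=> p0 /andP[s0 s1] x0; rewrite !mevalE mulr_sumr ler_sum// => m _.
have [->|mn0] := eqVneq m mnm0; first by rewrite p0 !mul0r mulr0.
rewrite mulrCA ler_wpM2l//.
under eq_bigr do rewrite exprMn.
rewrite big_split /= ler_wpM2r//; first by rewrite prodr_ge0// => i _; rewrite exprn_ge0.
have [i mi] : exists i, m i != 0%N.
  apply/existsP; apply: contraNT mn0; rewrite negb_exists => /forallP h.
  by apply/eqP/mnmP => i; rewrite mnm0E; apply/eqP; move: (h i); rewrite negbK.
rewrite (bigD1 i)//= -[leRHS]mulr1; apply: ler_pM.
- exact: exprn_ge0.
- by rewrite prodr_ge0// => j _; rewrite exprn_ge0.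
- by case: (m i) mi => // k _; rewrite exprS ler_piMr// exprn_ile1.
- by rewrite prodr_ile1// => j; rewrite exprn_ge0//= exprn_ile1.
Qed.

(* Polarization: [2 |A| |B| <= |A| ^ 2 + |B| ^ 2] monomial by monomial. *)
Lemma norm_meval_mul_conj a b :
  `|meval (fun i => a i * (b i)^*) p| <=
  (meval (fun i => a i * (a i)^*) p + meval (fun i => b i * (b i)^*) p) / 2.
Proof.
rewrite !mevalE -big_split /= mulr_suml.
apply: (le_trans (ler_norm_sum _ _ _)); apply: ler_sum => m _.
have monoE u v : \prod_i (u i * (v i)^*) ^+ m i
    = (\prod_i u i ^+ m i) * (\prod_i v i ^+ m i)^* :> C.
  rewrite rmorph_prod -big_split /=; apply: eq_bigr => i _.
  by rewrite exprMn rmorphXn.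
rewrite !monoE -!normCK -mulrDr -mulrA normrM ger0_norm// ler_wpM2l//.
rewrite normrM norm_conjC ler_pdivlMr// -subr_ge0.
rewrite (_ : _ - _ = (`|\prod_i a i ^+ m i| - `|\prod_i b i ^+ m i|) ^+ 2); last by ring.
by rewrite real_exprn_even_ge0// rpredB// normr_real.
Qed.

End NonnegativePolynomials.

(** * Positive regular tuples *)

Section PositiveRegular.
Variables (R : realType) (n : nat).
Local Notation C := (Cplx R).
Variable P : 'I_n -> mpoly n C.
Hypothesis P_regular : positive_regular P.
Implicit Types (z w : 'rV[C]_n) (j k : 'I_n).

Lemma positive_regular_ge0 j m : 0 <= mcoeff m (P j).
Proof. by have [h _] := P_regular j. Qed.

(** The linear term and the [Q k] are homogeneous of degree at least 1. *)
Lemma positive_regular_coeff0 j : mcoeff mnm0 (P j) = 0.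
Proof.
have [_ [a [N [Q [a0 Qhom ->]]]]] := P_regular j.
rewrite mcoeffD mcoeffZ mcoeffX mnm1_eq0 mulr0 add0r raddf_sum /= big_nat_cond.
apply: big1 => k /andP[/andP[k2 kN] _]; apply/eqP; apply/negPn/negP.
rewrite -mcoeff_msupp => m0.
have /allP/(_ _ m0) : all [pred m | mdeg m == k] (msupp (Q k)).
  by apply: Qhom; rewrite k2 -ltnS.
by rewrite /= mdeg0 eq_sym; case: k k2 {kN m0}.
Qed.

(** This is [P j (|w_1| ^ 2, ..., |w_n| ^ 2)]; at [w = phi z] it is the quantity that defines the
    triangle. *)
Definition modulus_sq w j : C := meval (fun i => w 0 i * (w 0 i)^*) (P j).

Lemma diamondE z w : (diamond z (conj_vec w) 0 : 'I_n -> C) = fun i => z 0 i * (w 0 i)^*.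
Proof. by apply/funext => i; rewrite !mxE. Qed.

Lemma mul_conj_ge0 (x : C) : 0 <= x * x^*.
Proof. by rewrite -normCK exprn_ge0. Qed.

Lemma modulus_sq_ge0 w j : 0 <= modulus_sq w j.
Proof.
by apply: meval_ge0 => [|i]; [exact: positive_regular_ge0|exact: mul_conj_ge0].
Qed.

Lemma ler_modulus_sq w w' j : (forall i, `|w 0 i| <= `|w' 0 i|) ->
  modulus_sq w j <= modulus_sq w' j.
Proof.
move=> ww; apply: ler_meval => [|i]; first exact: positive_regular_ge0.
by rewrite mul_conj_ge0 -!normCK lerXn2r// nnegrE.
Qed.

(** With [S] the sum of all [P j (1, ..., 1)] and [e = 1 / (1 + S)], absence of constant terms
    bounds the value by [e ^ 2 S <= e S < 1], for all [j] at once. *)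
Lemma modulus_sq_small : exists2 d : R, 0 < d &
  forall w, (forall i, `|w 0 i| <= (d%:C)%C) -> forall j, modulus_sq w j < 1.
Proof.
pose S := \sum_j meval (fun=> 1) (P j).
have P1 j : 0 <= meval (fun=> 1) (P j).
  by apply: meval_ge0 => //; exact: positive_regular_ge0.
have S0 : 0 <= S by apply: sumr_ge0.
have S1 : 0 < 1 + S by rewrite ltr_pwDl.
pose e : C := (1 + S)^-1.
have e0 : 0 < e by rewrite invr_gt0.
have eE : ((Re e)%:C)%C = e by apply: RRe_real; rewrite realE ltW.
have e1 : e <= 1 by rewrite invf_le1// lerDl.
exists (Re e); first by rewrite -ltcR eE.
rewrite eE => w we j.
have e2 : 0 <= e ^+ 2 <= 1 by rewrite exprn_ge0 ?exprn_ile1 ?(ltW e0).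
apply: (@le_lt_trans _ _ (meval (fun=> e ^+ 2 * 1) (P j))).
  apply: ler_meval => [|i]; first exact: positive_regular_ge0.
  by rewrite mul_conj_ge0 -normCK mulr1 lerXn2r// nnegrE ltW.
have PZ := meval_scale_le (positive_regular_ge0 j) (positive_regular_coeff0 j) e2.
apply: (le_lt_trans (PZ _ _)) => //.
apply: (@le_lt_trans _ _ (e * S)).
  apply: ler_pM; rewrite ?exprn_ge0 ?(ltW e0)//.
    by rewrite expr2 ler_piMr// ltW.
  by rewrite /S (bigD1 j)//= lerDl sumr_ge0.
by rewrite /e mulrC ltr_pdivrMr// mul1r ltrDr.
Qed.

End PositiveRegular.

(** * The boundary of the triangle *)

Section PTriangleBoundary.
Variables (R : realType) (n : nat).
Local Notation C := (Cplx R).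
Variable P : 'I_n -> mpoly n C.
Hypothesis P_regular : positive_regular P.
Implicit Types (z w p : 'rV[C]_n) (j k : 'I_n).

(** The domain of [phi]. Indices start at 0, so only the first coordinate may vanish. *)
Definition nonvanishing : set 'rV[C]_n :=
  [set z | forall k : 'I_n, (0 < k)%N -> z 0 k != 0].

Lemma P_triangleE :
  P_triangle P = [set z | nonvanishing z /\ forall j, modulus_sq P (phi z) j < 1].
Proof.
by apply/seteqP; split=> z [z0 zP]; split=> // j; move: (zP j);
  rewrite /modulus_sq -diamondE.
Qed.

Lemma phi_differentiable z j : nonvanishing z ->
  differentiable (fun z => phi z 0 j : C) z.
Proof.
move=> z0; case E: (insub j.+1 : option 'I_n) => [k|].
  have -> : (fun z => phi z 0 j : C) = fun z => z 0 j * (z 0 k)^-1.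
    by apply/funext => y; rewrite mxE E.
  apply: differentiableM; first exact: differentiable_coord.
  apply: differentiableV; first exact: differentiable_coord.
  by apply: z0; move: E; case: insubP => // i _ ij [<-]; rewrite ij.
have -> : (fun z => phi z 0 j : C) = fun z => z 0 j.
  by apply/funext => y; rewrite mxE E.
exact: differentiable_coord.
Qed.

Lemma conj_continuous : continuous (fun x : C => x^*).
Proof.
move=> x; apply/(@cvgrPdist_lt _ _ _ _ (nbhs_filter x)) => e e0; apply/nbhs_ballP.
exists e => // y xy; rewrite -rmorphB norm_conjC.
exact: xy.
Qed.

Lemma modulus_sq_phi_continuous z j : nonvanishing z ->
  {for z, continuous (fun z => modulus_sq P (phi z) j)}.
Proof.
move=> z0.
apply: (@meval_closed _ _ (P j) _ (fun f => {for z, continuous f})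
  (fun z i => phi z 0 i * (phi z 0 i)^*)).
- by move=> c; exact: cst_continuous.
- by move=> f g fc gc; exact (@continuousD C C 'rV[C]_n _ _ _ fc gc).
- by move=> f g fc gc; exact (@continuousM C 'rV[C]_n _ _ _ fc gc).
move=> i.
have pc : {for z, continuous (fun z => phi z 0 i : C)}.
  by apply: differentiable_continuous; exact: phi_differentiable.
have cc : {for z, continuous (fun z => (phi z 0 i)^* : C)}.
  exact (@continuous_comp _ _ _ _ (fun x : C => x^*) z pc (@conj_continuous _)).
exact (@continuousM C 'rV[C]_n _ _ _ pc cc).
Qed.

Lemma P_triangle_open : open (P_triangle P).
Proof.
rewrite P_triangleE openE => z [z0 zP]; have zF := nbhs_filter z.
have N1 : nbhs z (fun y : 'rV[C]_n => forall k : 'I_n, (0 < k)%N -> y 0 k != 0).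
  apply: (@filter_forall _ _
    (fun (k : 'I_n) (y : 'rV[C]_n) => (0 < k)%N -> y 0 k != 0) _ zF) => k.
  have [k0|k0] := posnP k; first by apply: (@filterE _ _ zF).
  have kc : {for z, continuous (fun y : 'rV[C]_n => y 0 k : C)}.
    by apply: differentiable_continuous; exact: differentiable_coord.
  have zk : 0 < `|z 0 k| by rewrite normr_gt0 z0.
  have := near_dist_lt kc zk.
  apply: filterS => y yz _; apply: contraTneq yz => ->.
  by rewrite subr0 ltxx.
have N2 : nbhs z (fun y : 'rV[C]_n => forall j, modulus_sq P (phi y) j < 1).
  apply: (@filter_forall _ _ (fun j y => modulus_sq P (phi y) j < 1) _ zF) => j.
  have zj : 0 < 1 - modulus_sq P (phi z) j by rewrite subr_gt0.
  have := near_dist_lt (@modulus_sq_phi_continuous z j z0) zj.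
  apply: filterS => y yz.
  (* The order of [C] is partial; as the values are nonnegative, they equal their norms and the
     triangle inequality applies. *)
  rewrite -[ltLHS]ger0_norm ?modulus_sq_ge0//.
  rewrite -[modulus_sq P (phi y) j](subKr (modulus_sq P (phi z) j)).
  apply: (le_lt_trans (ler_normB _ _)).
  by rewrite ger0_norm ?modulus_sq_ge0// -ltrBrDl.
by apply: filterS (filterI N1 N2) => y [].
Qed.

Lemma P_triangle_barrier p : closure (P_triangle P) p -> ~ P_triangle P p ->
  exists q, [/\ holomorphic (P_triangle P) q, forall z, P_triangle P z -> q z != 0,
                {for p, continuous q} & q p = 0].
Proof.
rewrite P_triangleE => clp nWp.
case: (pselect (nonvanishing p)) => [p0|]; last first.
  move=> /existsNP[k /not_implyP[k0 /negP/negPn/eqP pk]].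
  exists (fun z => z 0 k); split; last exact: pk.
  - by move=> z _; exact: differentiable_coord.
  - by move=> z [z0 _]; exact: z0.
  - by apply: differentiable_continuous; exact: differentiable_coord.
have [j pj] : exists j, ~ modulus_sq P (phi p) j < 1.
  by apply/existsNP => pP; apply: nWp; split.
(* At least 1 as [p] is outside the triangle, at most 1 by continuity as [p] is in its closure. *)
have pj1 : modulus_sq P (phi p) j = 1.
  apply/eqP; rewrite eq_le; apply/andP; split; last first.
    move/negP: pj; rewrite real_ltNge ?negbK// ?real1//.
    by rewrite ger0_real// modulus_sq_ge0.
  rewrite real_leNgt ?real1 ?ger0_real ?modulus_sq_ge0//; apply/negP => p1.
  have e0 : 0 < modulus_sq P (phi p) j - 1 by rewrite subr_gt0.
  have [y [[_ yP] /=]] := clp _ (near_dist_lt (@modulus_sq_phi_continuous p j p0) e0).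
  rewrite ger0_norm ?subr_ge0 ?ltW ?(lt_trans (yP j))//.
  by rewrite ltrD2l ltrN2 => /(lt_trans (yP j)); rewrite ltxx.
(* The conjugate factor is frozen at [p], which leaves a function holomorphic in [z]. *)
pose q z := 1 - meval (fun i => phi z 0 i * (phi p 0 i)^*) (P j).
have dq z : nonvanishing z -> differentiable q z.
  move=> z0; apply: differentiableB; first exact: differentiable_cst.
  apply: (@meval_closed _ _ (P j) _ (fun f => differentiable f z)
    (fun z i => phi z 0 i * (phi p 0 i)^*)).
  - by move=> c; exact: differentiable_cst.
  - by move=> f g df dg; exact: differentiableD.
  - by move=> f g df dg; exact: differentiableM.
  move=> i; apply: differentiableM; last exact: differentiable_cst.
  exact: phi_differentiable.
exists q; split.
- by move=> z [z0 _]; exact: dq.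
- move=> z [_ zP]; rewrite subr_eq0 eq_sym; apply/eqP => q1.
  (* A zero of [q] would give [2 <= modulus_sq P (phi z) j + 1]. *)
  have := norm_meval_mul_conj (positive_regular_ge0 P_regular j)
    (fun i => phi z 0 i) (fun i => phi p 0 i).
  rewrite q1 normr1 -/(modulus_sq P (phi z) j) -/(modulus_sq P (phi p) j) pj1.
  rewrite ler_pdivlMr// mul1r => le2.
  by move: (zP j) le2; rewrite -natr1 lerD2r => /lt_geF ->.
- by apply: differentiable_continuous; exact: dq.
- by rewrite /q -/(modulus_sq P (phi p) j) pj1 subrr.
Qed.

End PTriangleBoundary.

(** * Connectedness of the triangle *)

Section Segments.
Variables (R : realType) (n : nat).
Local Notation C := (Cplx R).
Implicit Types (x y : 'rV[C]_n) (z : C) (t d : R).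

Lemma continuous_rV (T : topologicalType) (f : T -> 'rV[C]_n) (v : T) :
  (forall j, {for v, continuous (fun s => f s 0 j : C)}) -> {for v, continuous f}.
Proof.
move=> fc; apply/(@cvg_ballP _ _ _ _ (nbhs_filter v)) => e e0.
have : nbhs v (fun s : T => forall j, ball (f v 0 j : C) e (f s 0 j : C)).
  apply: (@filter_forall _ _
    (fun j s => ball (f v 0 j : C) e (f s 0 j : C)) _ (nbhs_filter v)) => j.
  exact: (@cvg_ballP _ _ _ _ (nbhs_filter v) _ (f v 0 j : C)).1 (fc j) e e0.
apply: filterS => s hs; split=> // i j.
by rewrite (ord1 i).
Qed.

Definition seg x y : set 'rV[C]_n :=
  [set x + ((t +i* 0)%C : C) *: (y - x) | t in `[0, 1]%classic].

Lemma seg_connected x y : connected (seg x y).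
Proof.
apply: connected_continuous_connected; first exact: segment_connected.
apply: continuous_subspaceT => t; apply: continuous_rV => j.
have c1 : {for t, continuous (fun t : R => (t +i* 0)%C : C)} by exact: hline_continuous.
have c2 : {for t, continuous (fun=> (y - x) 0 j : C)} by exact: cst_continuous.
have c3 : {for t, continuous (fun=> x 0 j : C)} by exact: cst_continuous.
have -> : (fun t : R => (x + ((t +i* 0)%C : C) *: (y - x)) 0 j : C)
    = fun t => x 0 j + ((t +i* 0)%C : C) * (y - x) 0 j.
  by apply/funext => s; rewrite !mxE.
exact (@continuousD C C R _ _ _ c3 (@continuousM C R _ _ _ c1 c2)).
Qed.

Lemma seg_left x y : seg x y x.
Proof.
exists 0; first by rewrite /= in_itv /= lexx ler01.
by rewrite [X in X *: _](_ : _ = 0) ?scale0r ?addr0.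
Qed.

Lemma seg_right x y : seg x y y.
Proof.
exists 1; first by rewrite /= in_itv /= lexx ler01.
by rewrite [X in X *: _](_ : _ = 1) ?scale1r ?subrKC.
Qed.

(** In the order of [C], [0 <= t <= 1] already makes [t] real, so the later estimates stay within
    [C]. *)
Lemma segP x y (A : set 'rV[C]_n) :
  (forall (t : C), 0 <= t <= 1 -> A (x + t *: (y - x))) -> seg x y `<=` A.
Proof.
move=> h _ [t + <-]; rewrite /= in_itv /= => /andP[t0 t1]; apply: h.
by rewrite !lecE /= eqxx t0 t1.
Qed.

Lemma norm_convex_le (z1 z2 t e : C) : 0 <= t <= 1 -> `|z1| <= e -> `|z2| <= e ->
  `|z1 + t * (z2 - z1)| <= e.
Proof.
move=> /andP[t0 t1] h1 h2.
have -> : z1 + t * (z2 - z1) = (1 - t) * z1 + t * z2 by ring.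
rewrite (le_trans (ler_normD _ _))// !normrM (ger0_norm t0) ger0_norm ?subr_ge0//.
rewrite (_ : e = (1 - t) * e + t * e); last by ring.
by rewrite lerD// ler_wpM2l// subr_ge0.
Qed.

(* Chosen so that the segments from [z != 0] to [pole d z] and from there to [d]
   avoid the origin. *)
Definition pole d z : C := if 0 <= Im z then (0 +i* d)%C else (0 -i* d)%C.

Lemma norm_pole d z : 0 < d -> `|pole d z| = (d%:C)%C.
Proof.
move=> d0; rewrite /pole normr_normc; congr (_%:C)%C.
by case: ifP => _ /=; rewrite expr0n /= add0r ?sqrrN sqrtr_sqr ger0_norm// ltW.
Qed.

(** The imaginary parts of [z] and of its pole never have opposite signs, so the imaginary part can
    vanish only at [t = 0], where the point is [z]. *)
Lemma seg_pole_neq0 d z (t : C) : 0 < d -> z != 0 -> 0 <= t <= 1 ->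
  z + t * (pole d z - z) != 0.
Proof.
case: z t => a b [t t'] d0 z0; rewrite !lecE /= => /andP[/andP[/eqP t'0 t0] /andP[_ t1]].
rewrite t'0; apply: contra_neq z0 => /eqP.
rewrite /pole /=; case: (lerP 0 b) => b0; rewrite eq_complex /= => /andP[/eqP h1 /eqP h2].
- have tn : t = 0.
    have h3 : (1 - t) * b + t * d = 0 by lra.
    have h4 : 0 <= (1 - t) * b by rewrite mulr_ge0// subr_ge0.
    have h5 : t * d = 0.
      have : 0 <= t * d by rewrite mulr_ge0// ltW.
      lra.
    by move/eqP: h5; rewrite mulf_eq0 (gt_eqF d0) orbF => /eqP.
  move: h1 h2; rewrite tn !mul0r subr0 addr0 add0r addr0 => -> ->.
  by [].
- exfalso.
  have h3 : (1 - t) * (- b) + t * d = 0 by lra.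
  have h4 : 0 <= (1 - t) * (- b) by rewrite mulr_ge0 ?subr_ge0// oppr_ge0 ltW.
  have h5 : 0 <= t * d by rewrite mulr_ge0// ltW.
  have : t * d = 0 by lra.
  move/eqP; rewrite mulf_eq0 (gt_eqF d0) orbF => /eqP tn.
  by move: h3; rewrite tn subr0 mul1r mul0r addr0; lra.
Qed.

(** The real part [t d] vanishes only at [t = 0], where the point is the pole. *)
Lemma seg_base_neq0 d z (t : C) : 0 < d -> 0 <= t <= 1 ->
  pole d z + t * ((d%:C)%C - pole d z) != 0.
Proof.
case: t => t t' d0; rewrite !lecE /= => /andP[/andP[/eqP t'0 t0] /andP[_ t1]].
rewrite t'0; apply/eqP => /eqP.
rewrite /pole; case: ifP => _; rewrite eq_complex /= => /andP[/eqP h1 /eqP h2].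
- have : t * d = 0 by lra.
  move/eqP; rewrite mulf_eq0 (gt_eqF d0) orbF => /eqP tn.
  by move: h2; rewrite tn; lra.
- have : t * d = 0 by lra.
  move/eqP; rewrite mulf_eq0 (gt_eqF d0) orbF => /eqP tn.
  by move: h2; rewrite tn; lra.
Qed.

End Segments.

(** * The Reinhardt model of the triangle *)

Section PTriangleConnected.
Variables (R : realType) (n : nat).
Local Notation C := (Cplx R).
Variable P : 'I_n -> mpoly n C.
Hypothesis P_regular : positive_regular P.
Implicit Types (z w : 'rV[C]_n) (j k : 'I_n).

(** The inverse of [phi]: the quotients of consecutive coordinates telescope. *)
Definition psi w : 'rV[C]_n := \row_j \prod_(i < n | (j <= i)%N) w 0 i.

(** The recursion from the last coordinate downwards, in the shape of the definition of [phi]; the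
    empty product after the last index gives the 1. *)
Lemma psiE w j :
  psi w 0 j = w 0 j * (if insub j.+1 is Some k then psi w 0 k else 1).
Proof.
rewrite mxE (bigD1 j)//=; congr (_ * _).
case: insubP => [k _ kj|]; last first.
  rewrite -leqNgt => nj; apply: big_pred0 => i; apply/negbTE.
  rewrite negb_and negbK -implybE; apply/implyP => ji.
  by rewrite -val_eqE eqn_leq ji -ltnS (leq_trans (ltn_ord i) nj).
rewrite mxE; apply: eq_bigl => i.
by rewrite kj andbC eq_sym -val_eqE -ltn_neqAle.
Qed.

Lemma psi_nonvanishing w : nonvanishing w -> nonvanishing (psi w).
Proof.
move=> w0 k k0; rewrite mxE prodf_seq_neq0; apply/allP => i _; apply/implyP => ki.
exact: w0 (leq_trans k0 ki).
Qed.

Lemma phi_nonvanishing z : nonvanishing z -> nonvanishing (phi z).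
Proof.
move=> z0 j j0; rewrite mxE; case: insubP => [k _ kj|_]; last exact: z0.
by rewrite mulf_neq0 ?invr_eq0// z0// kj.
Qed.

Lemma psiK w : nonvanishing w -> phi (psi w) = w.
Proof.
move=> w0; apply/rowP => j; rewrite mxE psiE.
case: insubP => [k _ kj|_]; last by rewrite mulr1.
by rewrite mulfK// psi_nonvanishing// kj.
Qed.

Lemma phiK z : nonvanishing z -> psi (phi z) = z.
Proof.
move=> z0; apply/rowP => j.
(* Induction from the last coordinate down to the first. *)
have [m] := ubnP (n - j); elim: m j => // m IH j; rewrite ltnS => jm.
rewrite psiE mxE; case: insubP => [k kn kj|_]; last by rewrite mulr1.
rewrite IH ?divfK//; first by rewrite z0// kj.
by rewrite kj; apply: leq_trans jm; rewrite ltn_sub2l.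
Qed.

Lemma psi_continuous : continuous psi.
Proof.
move=> w; apply: continuous_rV => j.
have -> : (fun w => psi w 0 j : C) = fun w => \prod_(i <- index_enum 'I_n | (j <= i)%N) w 0 i.
  by apply/funext => u; rewrite mxE.
elim: (index_enum _) => [|i s IH].
  rewrite (_ : (fun _ => _) = fun=> 1); first exact: cst_continuous.
  by apply/funext => u; rewrite big_nil.
case ji : (j <= i)%N; last first.
  rewrite (_ : (fun _ => _) = fun w => \prod_(i <- s | (j <= i)%N) w 0 i) //.
  by apply/funext => u; rewrite big_cons ji.
rewrite (_ : (fun _ => _) = fun w => w 0 i * \prod_(i <- s | (j <= i)%N) w 0 i).
  have ci : {for w, continuous (fun w : 'rV[C]_n => w 0 i : C)}.
    by apply: differentiable_continuous; exact: differentiable_coord.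
  exact (@continuousM C 'rV[C]_n _ _ _ ci IH).
by apply/funext => u; rewrite big_cons ji.
Qed.

(** The image of the triangle under [phi]; membership depends on the moduli of the coordinates
    only. *)
Definition reinhardt : set 'rV[C]_n :=
  [set w | nonvanishing w /\ forall j, modulus_sq P w j < 1].

Lemma P_triangle_psi : P_triangle P = psi @` reinhardt.
Proof.
rewrite P_triangleE; apply/seteqP; split=> [z [z0 zP]|_ [w [w0 wP] <-]].
  by exists (phi z); [split=> //; exact: phi_nonvanishing|exact: phiK].
by split; [exact: psi_nonvanishing|rewrite psiK].
Qed.

Lemma shrink_exists (d : R) w : 0 < d ->
  exists2 e : C, 0 < e <= 1 & forall i, `|e * w 0 i| <= (d%:C)%C.
Proof.
move=> d0; pose D : C := (d%:C)%C; have D0 : 0 < D by rewrite ltcR.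
pose S : C := \sum_i `|w 0 i|.
have S0 : 0 <= S by rewrite sumr_ge0.
have DS : 0 < D + S by rewrite ltr_pwDl.
(* The summand [D] keeps the factor at most 1 and its denominator positive, even for [w = 0]. *)
exists (D / (D + S)); first by rewrite divr_gt0//= ler_pdivrMr// mul1r lerDl.
move=> i; rewrite normrM ger0_norm ?divr_ge0 ?(ltW D0) ?(ltW DS)//.
rewrite mulrAC ler_pdivrMr// ler_wpM2l ?(ltW D0)//.
rewrite /S (bigD1 i)//= addrCA lerDl addr_ge0 ?(ltW D0)//.
by rewrite sumr_ge0.
Qed.

Lemma reinhardt_shrink w (e : C) : 0 < e <= 1 -> reinhardt w -> reinhardt (e *: w).
Proof.
move=> /andP[e0 e1] [w0 wP]; split=> [k k0|j].
  by rewrite mxE mulf_neq0 ?w0// gt_eqF.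
apply: le_lt_trans (wP j); apply: ler_modulus_sq => // i.
by rewrite mxE normrM ger0_norm ?(ltW e0)// ler_piMl.
Qed.

(* Shrink radially into a small polydisc, then move all coordinates at once to
   [+-id] and on to [d]. *)
Lemma reinhardt_connected : connected reinhardt.
Proof.
have [d d0 dP] := modulus_sq_small P_regular.
pose D : C := (d%:C)%C; pose base : 'rV[C]_n := const_mx D.
have ball_reinhardt w : nonvanishing w -> (forall i, `|w 0 i| <= D) -> reinhardt w.
  by move=> w0 wd; split=> // j; exact: dP.
have normD : `|D| = D by rewrite ger0_norm// lecR ltW.
(* Membership of [w] is a premise under the existential, so that [choice] gives a set for each
   [w]. *)
have path w : exists A : set 'rV[C]_n, reinhardt w ->
    [/\ connected A, A `<=` reinhardt, A w & A base].
  case: (pselect (reinhardt w)) => [rw|nrw]; last by exists set0.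
  have [e e01 ed] := shrink_exists w d0.
  pose u := e *: w; pose v : 'rV[C]_n := \row_i pole d (u 0 i).
  exists (seg w u `|` seg u v `|` seg v base) => _.
  have ru : reinhardt u by exact: reinhardt_shrink.
  have uD i : `|u 0 i| <= D by rewrite mxE.
  have vD i : `|v 0 i| <= D by rewrite mxE norm_pole.
  split.
  - apply: connectedU; [|apply: connectedU|]; try exact: seg_connected.
    + by exists v; split; [right; exact: seg_right|exact: seg_left].
    + by exists u; split; [exact: seg_right|exact: seg_left].
  - rewrite !subUset; split; [split|]; apply: segP => t t01.
    (* The first segment consists of multiples of [w] with factor in []0, 1]]. *)
    + have -> : w + t *: (u - w) = (1 - t + t * e) *: w.
        rewrite /u scalerBr scalerA scalerDl scalerBl scale1r.
        by rewrite addrA addrAC.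
      case/andP: t01 => t0 t1; case/andP: e01 => e0 e1.
      apply: reinhardt_shrink => //; apply/andP; split; last first.
        by rewrite -subr_ge0 (_ : _ - _ = t * (1 - e)) ?mulr_ge0 ?subr_ge0//; ring.
      move: t0; rewrite le_eqVlt => /orP[/eqP <-|t0].
        by rewrite subr0 mul0r addr0.
      by rewrite ltr_wpDl ?subr_ge0// mulr_gt0.
    (* Convexity keeps this segment and the next in the polydisc of radius [d], where only
       nonvanishing is left to check. *)
    + apply: ball_reinhardt => [k k0|i].
        by rewrite !mxE seg_pole_neq0//; have := ru.1 k k0; rewrite mxE.
      by have := norm_convex_le t01 (uD i) (vD i); rewrite !mxE.
    + apply: ball_reinhardt => [k k0|i].
        by rewrite !mxE seg_base_neq0.
      have bD : `|base 0 i| <= D by rewrite mxE normD.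
      by have := norm_convex_le t01 (vD i) bD; rewrite !mxE.
  - by left; left; exact: seg_left.
  - by right; exact: seg_right.
have [A AP] := choice path.
(* A union of connected sets that all contain [base]. *)
have -> : reinhardt = \bigcup_(w in reinhardt) A w.
  apply/seteqP; split=> [w rw|w [u ru]]; first by exists w => //; case: (AP w rw).
  by case: (AP u ru) => _ + _ _; exact.
apply: bigcup_connected; first by exists base => w rw; case: (AP w rw).
by move=> w rw; case: (AP w rw).
Qed.

Lemma reinhardt_nonempty : reinhardt !=set0.
Proof.
have [d d0 dP] := modulus_sq_small P_regular.
exists (const_mx ((d%:C)%C : C)); split=> [k _|j].
  by rewrite mxE gt_eqF// ltcR.
by apply: dP => i; rewrite mxE ger0_norm// lecR ltW.
Qed.

Lemma P_triangle_domain : domain (P_triangle P).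
Proof.
split; first exact: P_triangle_open.
  rewrite P_triangle_psi; apply: connected_continuous_connected.
    exact: reinhardt_connected.
  by apply: continuous_subspaceT; exact: psi_continuous.
rewrite P_triangle_psi; have [w rw] := reinhardt_nonempty.
by exists (psi w); exists w.
Qed.

End PTriangleConnected.

Theorem proposition2p5 (R : realType) (n : nat) (hn : (2 <= n)%N)
    (P : 'I_n -> mpoly n (Cplx R)) (hP : positive_regular P) :
  domain_of_holomorphy (P_triangle P).
Proof.
apply: domain_of_holomorphyP; first exact: P_triangle_domain.
by move=> p; exact: P_triangle_barrier.
Qed.
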